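(* (i) For every integer $k\geq 2$ there exists an ergodic measure preserving system $(X,\mathcal{B},\mu,T)$ such that $\mathcal{E}_k(T)^\perp\neq\mathcal{E}_k(T^2)^\perp$. (ii) For every integer $k\geq 2$ there exist an ergodic (but not totally ergodic) measure preserving system $(X,\mathcal{B},\mu,T)$ and a function $f\in L^\infty(\mu)$ with $f\in\mathcal{E}_k(T)^\perp$ such that the following fails: for $\mu$-a.e. $x\in X$, for every continuous $\phi\colon\mathbb{T}\to\mathbb{C}$ and every $P\in\mathbb{R}_k[t]$, $\lim_{N\to\infty}\frac1N\sum_{n=1}^N\phi(P(n))f(T^nx)=0$. Consequently, the equivalence of the conditions ''(i) $f\in\mathcal{E}_k(T)^\perp$'', ''(ii) for a.e. $x$, for all continuous $\phi$ and $P\in\mathbb{R}_k[t]$, $\lim_{N}\frac1N\sum_{n=1}^N\phi(P(n))f(T^nx)=0$'', and ''(iii) for a.e. $x$, for all continuous $\phi$, $\lim_N\sup_{P\in\mathbb{R}_k[t]}|\frac1N\sum_{n=1}^N\phi(P(n))f(T^nx)|=0$'', which holds for totally ergodic systems, fails in general when total ergodicity is replaced by ergodicity.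
   Context: A measure preserving system consists of a probability space $(X,\mathcal{B},\mu)$ and a measure preserving map $T$; $Tf=f\circ T$. A system is ergodic if every $T$-invariant set has measure $0$ or $1$, and totally ergodic if $T^r$ is ergodic for all $r\in\mathbb{N}$. $\mathbb{T}=\mathbb{R}/\mathbb{Z}$. $\mathbb{R}_k[t]$ is the set of real polynomials of degree at most $k$. For an ergodic system $(X,\mathcal{B},\mu,S)$, $\mathcal{E}_0(S)$ is the set of eigenvalues of $S$, and inductively $\mathcal{E}_k(S)=\{f\in L^\infty(\mu):|f|=1,\ f\circ S\cdot\bar f\in\mathcal{E}_{k-1}(S)\}$; $\mathcal{E}_k(S)^\perp$ is the set of $f\in L^1(\mu)$ with $\int f\bar g\,d\mu=0$ for all $g\in\mathcal{E}_k(S)$. (For $S=T^2$, which need not be ergodic, the same inductive definition is used with $\mathcal{E}_0(T^2)$ the set of eigenvalues of $T^2$.) *)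

(* Defs.v *)
From HB Require Import structures.
From mathcomp Require Import all_boot all_order all_algebra.
From mathcomp Require Import all_classical all_reals all_analysis.
From mathcomp Require Import complex.
Set Implicit Arguments. Unset Strict Implicit. Unset Printing Implicit Defensive.
Import Order.TTheory GRing.Theory Num.Theory.
Import numFieldNormedType.Exports.
Local Open Scope classical_set_scope.
Local Open Scope ring_scope.

Section Defs.
Context (R : realType) (d : measure_display) (X : measurableType d).
Implicit Types (mu : probability X R) (S T : X -> X) (f g : X -> R[i]).

Definition cconj (z : R[i]) : R[i] := Complex (complex.Re z) (- complex.Im z).
Definition sqmod (z : R[i]) : R := complex.Re z ^+ 2 + complex.Im z ^+ 2.

Definition cmeasurable f :=
  measurable_fun setT (fun x => complex.Re (f x)) /\ measurable_fun setT (fun x => complex.Im (f x)).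
Definition cintegrable mu f :=
  mu.-integrable setT (fun x => (complex.Re (f x))%:E) /\ mu.-integrable setT (fun x => (complex.Im (f x))%:E).
Definition cLinfty mu f := cmeasurable f /\ exists M : R, {ae mu, forall x, sqmod (f x) <= M}.
Definition cL2 mu f := cmeasurable f /\ mu.-integrable setT (fun x => (sqmod (f x))%:E).

Definition measure_preserving mu T :=
  measurable_fun setT T /\ forall A, measurable A -> mu (T @^-1` A) = mu A.
Definition ergodic mu T :=
  forall A, measurable A -> T @^-1` A = A -> mu A = 0%E \/ mu A = 1%E.
Definition totally_ergodic mu T := forall r : nat, (0 < r)%N -> ergodic mu (iter r T).

Definition is_eigenvalue mu S (c : R[i]) :=
  exists g, cL2 mu g /\ ~ {ae mu, forall x, g x = 0} /\ {ae mu, forall x, g (S x) = c * g x}.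

Fixpoint Ek (k : nat) mu S : set (X -> R[i]) :=
  match k with
  | 0 => [set f | cmeasurable f /\ exists c, is_eigenvalue mu S c /\ {ae mu, forall x, f x = c}]
  | k'.+1 => [set f | cmeasurable f /\ {ae mu, forall x, sqmod (f x) = 1} /\
              exists g, Ek k' mu S g /\ {ae mu, forall x, f (S x) * cconj (f x) = g x}]
  end.

Definition Ek_perp (k : nat) mu S : set (X -> R[i]) :=
  [set f | cmeasurable f /\ cintegrable mu f /\
     forall g, Ek k mu S g ->
       Rintegral mu setT (fun x => complex.Re (f x * cconj (g x))) = 0 /\
       Rintegral mu setT (fun x => complex.Im (f x * cconj (g x))) = 0].

(* continuous phi : TT = R/Z -> C, as a continuous 1-periodic function R -> C *)
Definition circle_continuous (phi : R -> R[i]) :=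
  (forall t, phi (t + 1) = phi t) /\
  continuous (fun t => complex.Re (phi t)) /\ continuous (fun t => complex.Im (phi t)).

Definition wavg T (phi : R -> R[i]) (P : {poly R}) f (x : X) (N : nat) : R[i] :=
  (N%:R)^-1 *: \sum_(1 <= n < N.+1) (phi P.[n%:R] * f (iter n T x)).

Definition ctends_to0 (u : nat -> R[i]) :=
  (fun N => complex.Re (u N)) @ \oo --> (0 : R) /\ (fun N => complex.Im (u N)) @ \oo --> (0 : R).

End Defs.

(* Main.v *)
(* One system serves both parts and every k. Let S(y, z) = (y + beta, z + y) on the 2-torus, with
   beta not commensurable with pi, and let T exchange two copies of the torus, T(w, 0) = (S w, 1) and
   T(w, 1) = (w, 0), so that T^2 = S on each copy. The function e(z) lies in E_2(T^2) because
   e(z) o S = e(y) e(z) and e(y) is an eigenfunction of S.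
   If F is in E_{k+1}(T) with F o T = G F, then F_0 = G_1 F_1 and F_1 o S = G_0 G_1 F_1, with
   indices denoting the copies. Comparing Fourier coefficients and using Bessel's inequality, a unimodular
   solution of f o S = c e(a y + b z) f exists only if b = 0, and it is then a multiple of some
   e(p y + a z). By induction on k, every G in E_k(T) is G_i = C_i e(l_i y + 2 m z) on copy i, with
   l_0 = l_1 when m = 0: the z-frequency of F_1 is l_0 + l_1 = 2 l, always even. Hence the function
   equal to e(z) on copy 0 and to 0 on copy 1 is orthogonal to E_k(T) for all k, but not to e(z).
   Along an orbit starting in copy 0 this function is a quadratic phase at even times and vanishes at
   odd times, so its average against the conjugate quadratic phase tends to 1/2. *)
Require Import Defs.
From HB Require Import structures.
From mathcomp Require Import all_boot all_order all_algebra.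
From mathcomp Require Import all_classical all_reals all_analysis.
From mathcomp Require Import measurable_realfun complex ring lra zify.
Set Implicit Arguments. Unset Strict Implicit. Unset Printing Implicit Defensive.
Import Order.TTheory GRing.Theory Num.Theory.
Import numFieldNormedType.Exports.
Local Open Scope classical_set_scope.
Local Open Scope ring_scope.

(** * Integrals of bounded functions *)

Section BoundedMeasurable.
Context (R : realType) (d : measure_display) (Y : measurableType d).
Implicit Types (f g : Y -> R) (a : R).

(** The bound holds everywhere, not just almost everywhere. Such functions form an algebra and are
    integrable against every probability, so integrals can be manipulated without side conditions on
    null sets. *)
Definition bmeas f := measurable_fun setT f /\ exists M : R, forall x, `|f x| <= M.

Lemma bmeas_cst a : bmeas (fun=> a).
Proof. by split; [exact: measurable_cst | exists `|a|]. Qed.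

Lemma bmeasD f g : bmeas f -> bmeas g -> bmeas (fun x => f x + g x).
Proof.
move=> [mf [M hM]] [mg [N hN]]; split; first exact: measurable_funD.
by exists (M + N) => x; rewrite (le_trans (ler_normD _ _))// lerD.
Qed.

Lemma bmeasM f g : bmeas f -> bmeas g -> bmeas (fun x => f x * g x).
Proof.
move=> [mf [M hM]] [mg [N hN]]; split; first exact: measurable_funM.
by exists (M * N) => x; rewrite normrM ler_pM.
Qed.

Lemma bmeasZ a f : bmeas f -> bmeas (fun x => a * f x).
Proof. exact: bmeasM (bmeas_cst a). Qed.

Lemma bmeasN f : bmeas f -> bmeas (fun x => - f x).
Proof.
by move=> /(bmeasZ (-1)); under eq_fun do rewrite mulN1r.
Qed.

Lemma bmeasB f g : bmeas f -> bmeas g -> bmeas (fun x => f x - g x).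
Proof. by move=> bf bg; apply: bmeasD => //; exact: bmeasN. Qed.

Lemma bmeas_indic (A : set Y) : measurable A -> bmeas (\1_A).
Proof.
move=> mA; split; first exact: measurable_indic.
by exists 1 => x; rewrite indicE ger0_norm// lern1 leq_b1.
Qed.

(** Bounded pointwise convergence, the setting of dominated convergence with a constant majorant. *)
Definition blim (u : nat -> Y -> R) f :=
  [/\ forall n, measurable_fun setT (u n),
      exists M : R, forall n x, `|u n x| <= M
    & forall x, (fun n => u n x) @ \oo --> f x].

Lemma blim_bmeas u f : blim u f -> forall n, bmeas (u n).
Proof. by move=> [mu [M hM] _] n; split => //; exists M. Qed.

Lemma blim_bmeasr u f : blim u f -> bmeas f.
Proof.
move=> [mu [M hM] cu]; split.
  by apply: (measurable_fun_cvg mu) => x _; exact: cu.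
exists M => x; have cx : (fun n => `|u n x|) @ \oo --> `|f x| by apply: cvg_norm; exact: cu.
rewrite -(cvg_lim _ cx)//; apply: limr_le; first by apply/cvg_ex; exists `|f x|.
by apply: nearW => n; exact: hM.
Qed.

Lemma blimM u f g : blim u f -> bmeas g -> blim (fun n x => u n x * g x) (fun x => f x * g x).
Proof.
move=> [mu [M hM] cu] [mg [N hN]]; split.
- by move=> n; exact: measurable_funM.
- by exists (M * N) => n x; rewrite normrM ler_pM.
- by move=> x; apply: cvgM (cu x) _; exact: cvg_cst.
Qed.

End BoundedMeasurable.

Section BoundedIntegral.
Context (R : realType) (d : measure_display) (Y : measurableType d) (P : probability Y R).
Implicit Types (f g : Y -> R) (a : R).

Local Notation I f := (Rintegral P setT f).

Lemma bmeas_integrable f : bmeas f -> P.-integrable setT (EFin \o f).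
Proof.
move=> [mf [M hM]]; apply: measurable_bounded_integrable => //.
  by rewrite -ge0_fin_numE//; exact: fin_num_measure.
exists M; split; first exact: num_real.
by move=> N MN x _ /=; exact: le_trans (hM x) (ltW MN).
Qed.

Lemma bintegralE f : bmeas f -> (\int[P]_x (f x)%:E)%E = (I f)%:E.
Proof. by move=> bf; rewrite fineK//; apply: integrable_fin_num => //; exact: bmeas_integrable bf. Qed.

Lemma bintegralD f g : bmeas f -> bmeas g -> I (fun x => f x + g x) = I f + I g.
Proof. by move=> bf bg; rewrite RintegralD//; exact: bmeas_integrable. Qed.

Lemma bintegralB f g : bmeas f -> bmeas g -> I (fun x => f x - g x) = I f - I g.
Proof. by move=> bf bg; rewrite RintegralB//; exact: bmeas_integrable. Qed.

Lemma bintegralZ a f : bmeas f -> I (fun x => a * f x) = a * I f.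
Proof. by move=> bf; rewrite RintegralZl//; exact: bmeas_integrable. Qed.

Lemma bintegral_cst a : I (fun=> a) = a.
Proof. by rewrite Rintegral_cst// [X in fine X](_ : _ = 1%E) ?mulr1//; exact: probability_setT. Qed.

Lemma bintegral_indic A : measurable A -> I (\1_A) = fine (P A).
Proof. by move=> mA; rewrite /Rintegral integral_indic// setIT. Qed.

Lemma bintegral_ae f g : bmeas f -> bmeas g -> {ae P, forall x, f x = g x} -> I f = I g.
Proof.
move=> [mf _] [mg _] fg; rewrite /Rintegral; congr fine.
apply: ae_eq_integral => //; try exact/measurable_EFinP.
by apply: filterS fg => x /= -> .
Qed.

Lemma bintegral_lim u f : blim u f -> (fun n => I (u n)) @ \oo --> I f.
Proof.
move=> uf; have bf := blim_bmeasr uf; have bu := blim_bmeas uf.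
case: uf => mu [M hM] cu.
have := @dominated_convergence _ Y R P setT measurableT
  (fun n x => (u n x)%:E) (fun x => (f x)%:E) (fun=> M%:E).
case.
- by move=> n; exact/measurable_EFinP.
- by apply/measurable_EFinP; case: bf.
- by apply: aeW => x _; apply: cvg_EFin (cu x); exact: nearW.
- exact: (bmeas_integrable (bmeas_cst Y M)).
- by apply: aeW => x n _; rewrite /= lee_fin.
move=> _ _ H.
have finf : (\int[P]_x (f x)%:E)%E \is a fin_num.
  by apply: integrable_fin_num => //; exact: bmeas_integrable bf.
by apply: fine_cvg; rewrite fineK.
Qed.

End BoundedIntegral.

(** * Functionals determined by a multiplicative family *)

Section Cubic.
Context (R : realType).

(** This odd polynomial fixes -1, 0 and 1. Its derivative is 0 at -1 and 1 and 3/2 at 0, so on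
    [-1, 1] its iterates converge to the sign function. *)
Definition cubic (x : R) : R := (3 * x - x ^+ 3) / 2.

Lemma cubicN x : cubic (- x) = - cubic x.
Proof. by rewrite /cubic; field. Qed.

Lemma iter_cubicN n x : iter n cubic (- x) = - iter n cubic x.
Proof. by elim: n => // n IH; rewrite !iterS IH cubicN. Qed.

(* [1 - cubic y = (1 - y) * ((1 - y) * (2 + y) / 2)], and the second factor is at most [1 - x / 2]
   for [y >= x]. *)
Lemma iter_cubic_pos n x : 0 < x <= 1 ->
  x <= iter n cubic x <= 1 /\ 1 - iter n cubic x <= (1 - x / 2) ^+ n.
Proof.
move=> /andP[x0 x1]; elim: n => [|n [/andP[IH1 IH2] IH3]].
  by rewrite /= lexx x1 expr0; split => //; lra.
rewrite iterS; set y := iter n cubic x in IH1 IH2 IH3 *.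
have E : 1 - cubic y = (1 - y) * ((1 - y) * (2 + y) / 2) by rewrite /cubic; field.
have E2 : cubic y - y = y * (1 - y) * (1 + y) / 2 by rewrite /cubic; field.
have y0 : 0 < y by lra.
have h1 : 0 <= y * (1 - y) * (1 + y) / 2 by rewrite !mulr_ge0//; lra.
have h2 : 0 <= (1 - y) * ((1 - y) * (2 + y) / 2) by rewrite !mulr_ge0//; lra.
split; first by apply/andP; split; lra.
rewrite E exprSr ler_pM//; first by lra.
  by rewrite !mulr_ge0//; lra.
by nra.
Qed.

Lemma iter_cubic_norm n x : `|x| <= 1 -> `|iter n cubic x| <= 1.
Proof.
case: (ltrgt0P x) => [x0 | x0 | ->] x1; first last.
- elim: n => [|n IH]; first by rewrite normr0.
  rewrite iterS; suff -> : iter n cubic 0 = 0 by rewrite /cubic expr0n mulr0 subrr mul0r normr0.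
  by elim: n {IH} => // n IH; rewrite iterS IH /cubic expr0n mulr0 subrr mul0r.
- have /(iter_cubic_pos n)[/andP[h1 h2] _] : 0 < - x <= 1 by lra.
  by rewrite -normrN -iter_cubicN ger0_norm//; lra.
- have /(iter_cubic_pos n)[/andP[h1 h2] _] : 0 < x <= 1 by lra.
  by rewrite ger0_norm//; lra.
Qed.

Lemma cvg_iter_cubic x : `|x| <= 1 -> (fun n => iter n cubic x) @ \oo --> Num.sg x.
Proof.
have pos y : 0 < y <= 1 -> (fun n => iter n cubic y) @ \oo --> (1 : R).
  move=> y01; have /andP[y0 y1] := y01.
  have H : (fun n => 1 - (1 - y / 2) ^+ n) @ \oo --> (1 : R).
    rewrite -[X in _ --> X]subr0; apply: cvgB; first exact: cvg_cst.
    by apply: cvg_expr; rewrite ger0_norm; lra.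
  apply: (squeeze_cvgr _ H (cvg_cst _)).
  apply: nearW => n; have [/andP[_ h2] h3] := iter_cubic_pos n y01.
  by apply/andP; split; lra.
case: (ltrgt0P x) => [x0 | x0 | ->] x1; first last.
- rewrite sgr0 (_ : (fun n => _) = cst 0); first exact: cvg_cst.
  apply/funext => n /=; elim: n => // n IH.
  by rewrite iterS IH /cubic expr0n mulr0 subrr mul0r.
- rewrite ltr0_sg// (_ : (fun n => _) = (fun n => - iter n cubic (- x))).
    by apply: cvgN; apply: pos; lra.
  by apply/funext => n; rewrite iter_cubicN opprK.
- by rewrite gtr0_sg//; apply: pos; lra.
Qed.

End Cubic.

Section Determining.
Context (R : realType) (d : measure_display) (Y : measurableType d).
Variables (G : set (Y -> R)) (L : (Y -> R) -> R).
Hypothesis measG : @measurable d Y =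
  <<s [set A | exists2 g, G g & exists c : R, A = [set x | c < g x]] >>.
Hypothesis measurableG : forall g, G g -> measurable_fun setT g.
Hypothesis normG : forall g, G g -> forall x, `|g x| <= 1.
Hypothesis G1 : G (fun=> 1).
(** This is the shape of the product-to-sum formula for cosines: [G] is not closed under products,
    but its linear span is. *)
Hypothesis mulG : forall g h, G g -> G h ->
  exists g1 g2, [/\ G g1, G g2 & forall x, g x * h x = 2^-1 * (g1 x + g2 x)].
Hypothesis LD : forall f g, bmeas f -> bmeas g -> L (fun x => f x + g x) = L f + L g.
Hypothesis LZ : forall a f, bmeas f -> L (fun x => a * f x) = a * L f.
Hypothesis Llim : forall u f, blim u f -> (fun n => L (u n)) @ \oo --> L f.
Hypothesis LG : forall g, G g -> L g = 0.

(** The kernel of the linear functional [L] need not be stable under products. Multipliers of the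
    annihilated functions are, because multiplications compose. *)
Let annihilated (f : Y -> R) := bmeas f /\ forall g, G g -> L (fun x => f x * g x) = 0.
Let multiplier (w : Y -> R) :=
  bmeas w /\ forall f, annihilated f -> annihilated (fun x => w x * f x).

Let bG g : G g -> bmeas g.
Proof. by move=> Gg; split; [exact: measurableG | exists 1 => x; exact: normG]. Qed.

Let annD f g : annihilated f -> annihilated g -> annihilated (fun x => f x + g x).
Proof.
move=> [bf hf] [bg hg]; split; first exact: bmeasD.
move=> h Gh; under eq_fun do rewrite mulrDl.
by rewrite LD ?hf ?hg ?addr0//; apply: bmeasM => //; exact: bG.
Qed.

Let annZ a f : annihilated f -> annihilated (fun x => a * f x).
Proof.
move=> [bf hf]; split; first exact: bmeasZ.
move=> h Gh; under eq_fun do rewrite -mulrA.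
by rewrite LZ ?hf ?mulr0//; apply: bmeasM => //; exact: bG.
Qed.

Let ann_lim u f : (forall n, annihilated (u n)) -> blim u f -> annihilated f.
Proof.
move=> au uf; split; first exact: blim_bmeasr uf.
move=> h Gh; have := Llim (blimM uf (bG Gh)).
rewrite (_ : (fun n => _) = (fun=> 0)); last by apply/funext => n; exact: (au n).2.
by move=> /cvg_lim <-//; rewrite lim_cst.
Qed.

Let multD v w : multiplier v -> multiplier w -> multiplier (fun x => v x + w x).
Proof.
move=> [bv hv] [bw hw]; split; first exact: bmeasD.
by move=> f af; under eq_fun do rewrite mulrDl; apply: annD; [exact: hv | exact: hw].
Qed.

Let multM v w : multiplier v -> multiplier w -> multiplier (fun x => v x * w x).
Proof.
move=> [bv hv] [bw hw]; split; first exact: bmeasM.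
by move=> f af; under eq_fun do rewrite -mulrA; apply: hv; exact: hw.
Qed.

Let mult_cst a : multiplier (fun=> a).
Proof. by split; [exact: bmeas_cst | move=> f af; exact: annZ]. Qed.

Let multZ a w : multiplier w -> multiplier (fun x => a * w x).
Proof. exact: multM. Qed.

Let mult_lim u w : (forall n, multiplier (u n)) -> blim u w -> multiplier w.
Proof.
move=> mu uw; split; first exact: blim_bmeasr uw.
move=> f af; apply: (@ann_lim (fun n x => u n x * f x)) => [n|].
  exact: (mu n).2.
by apply: blimM uw _; case: af.
Qed.

(** By [mulG], testing [g * f] against [h] amounts to testing [f] against two members of [G]. *)
Let multG g : G g -> multiplier g.
Proof.
move=> Gg; split; first exact: bG.
move=> f [bf hf]; split; first by apply: bmeasM => //; exact: bG.
move=> h Gh; have [g1 [g2 [Gg1 Gg2 E]]] := mulG Gg Gh.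
rewrite (_ : (fun x => _) = (fun x => 2^-1 * (f x * g1 x + f x * g2 x))).
  have b1 : bmeas (fun x => f x * g1 x) by apply: bmeasM => //; exact: bG.
  have b2 : bmeas (fun x => f x * g2 x) by apply: bmeasM => //; exact: bG.
  by rewrite LZ ?LD ?hf ?addr0 ?mulr0//; exact: bmeasD.
by apply/funext => x; rewrite mulrAC mulrC [g x * _]E; ring.
Qed.

Let mult_iter_cubic n w : multiplier w -> multiplier (fun x => iter n (@cubic R) (w x)).
Proof.
move=> mw; elim: n => // n IH.
under eq_fun do rewrite iterS.
rewrite (_ : (fun x => _) = (fun x => (3 / 2) * iter n (@cubic R) (w x) +
    (- 2^-1) * (iter n (@cubic R) (w x) * (iter n (@cubic R) (w x) * iter n (@cubic R) (w x))))).
  by apply: multD; apply: multZ => //; apply: multM => //; exact: multM.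
by apply/funext => x; rewrite /cubic; field.
Qed.

Let mult_sg w : multiplier w -> (forall x, `|w x| <= 1) -> multiplier (fun x => Num.sg (w x)).
Proof.
move=> mw w1; apply: (mult_lim (fun n => mult_iter_cubic n mw)); split.
- by move=> n; case: (mult_iter_cubic n mw) => -[].
- by exists 1 => n x; exact: iter_cubic_norm.
- by move=> x; exact: cvg_iter_cubic.
Qed.

Let mult_level g (c : R) : G g -> multiplier (\1_[set x | c < g x]).
Proof.
(* The scaling brings [g - c] into [-1, 1], where the iterates of [cubic] converge, and keeps its
   sign. *)
move=> Gg; pose w x := (1 + `|c|)^-1 * (g x + - c).
have c0 : 0 < 1 + `|c| by rewrite ltr_pwDl.
have mw : multiplier w by apply: multZ; apply: multD => //; exact: multG.
have w1 x : `|w x| <= 1.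
  rewrite normrM gtr0_norm ?invr_gt0// ler_pdivrMl// mulr1.
  by rewrite (le_trans (ler_normB _ _))// lerD2r normG.
(* For a sign s, (s^2 + s) / 2 is 1 when s = 1 and 0 when s is 0 or -1; the strict inequality is
   thus respected at ties. *)
rewrite (_ : \1__ = (fun x => 2^-1 * (Num.sg (w x) * Num.sg (w x) + Num.sg (w x)))).
  by apply: multZ; apply: multD; [apply: multM|]; exact: mult_sg.
apply/funext => x; rewrite indicE.
have -> : Num.sg (w x) = Num.sg (g x - c) by rewrite sgrM gtr0_sg ?invr_gt0// mul1r.
have [cg|cg] := ltP c (g x).
  by rewrite mem_set//= gtr0_sg ?subr_gt0//; field.
rewrite memNset/=; last by apply/negP; rewrite -leNgt.
move: cg; rewrite le_eqVlt => /orP[/eqP ->|cg]; first by rewrite subrr sgr0; ring.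
by rewrite ltr0_sg ?subr_lt0//; ring.
Qed.

(** Products of indicators give intersections, so finite unions are available through complements,
    and countable unions are bounded limits of these. No separate monotone class argument is
    required. *)
Let mult_sigma : sigma_algebra setT [set A | measurable A /\ multiplier (\1_A)].
Proof.
have multC A : measurable A -> multiplier (\1_A) -> multiplier (\1_(~` A)).
  move=> mA hA; rewrite (_ : \1__ = (fun x => 1 + -1 * \1_A x)).
    by apply: multD => //; exact: multZ.
  apply/funext => x; rewrite !indicE in_setC; case: (x \in A) => /=; ring.
have multI A B : multiplier (\1_A) -> multiplier (\1_B) -> multiplier (\1_(A `&` B)).
  by move=> hA hB; rewrite indicI; exact: multM.
split.
- by split => //; rewrite indic0; exact: mult_cst.
- by move=> A [mA hA]; rewrite setTD; split; [exact: measurableC | exact: multC].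
move=> A hA; split; first by apply: bigcup_measurable => k _; exact: (hA k).1.
have mU n : measurable (\big[setU/set0]_(i < n) A i).
  by apply: bigsetU_measurable => i _; exact: (hA i).1.
apply: (@mult_lim (fun n => \1_(\big[setU/set0]_(i < n) A i))).
  elim=> [|n IH]; first by rewrite big_ord0 indic0; exact: mult_cst.
  rewrite big_ord_recr/= -[X in \1_X]setCK; apply: (multC _).
    by apply: measurableC; apply: measurableU; [exact: mU | exact: (hA n).1].
  rewrite setCU; exact: multI (multC _ (mU n) IH) (multC _ (hA n).1 (hA n).2).
split.
- by move=> n; exact: measurable_indic.
- by exists 1 => n x; rewrite indicE ger0_norm// lern1 leq_b1.
move=> x; apply: cvg_near_cst.
have [[k _ Akx]|nA] := pselect ((\bigcup_k A k) x).
  exists k.+1 => // n /= kn; rewrite !indicE !mem_set//; first by exists k.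
  by rewrite -bigcup_mkord; exists k.
apply: nearW => n; rewrite !indicE !memNset//.
by rewrite -bigcup_mkord => -[k _ Akx]; apply: nA; exists k.
Qed.

(* The multipliers form an algebra of functions closed under bounded pointwise limits. It contains [G],
   hence, by iterating [cubic] towards the sign function, the indicators of the level sets of [G]. *)
Lemma determining A : measurable A -> L (\1_A) = 0.
Proof.
move=> mA; have [_] : measurable A /\ multiplier (\1_A).
  move: mA; rewrite {1}measG.
  apply: (smallest_sub (X := [set B | measurable B /\ multiplier (\1_B)])); first exact: mult_sigma.
  move=> _ [g Gg [c ->]]; split; last exact: mult_level.
  have := measurableG Gg measurableT (measurable_itv `]c, +oo[).
  by rewrite setTI; congr measurable; apply/seteqP; split => x /=; rewrite in_itv/= andbT.
(* The constant 1 is annihilated because [L] vanishes on [G]. Hence so is [\1_A], and it is tested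
   against the member 1 of [G]. *)
case=> _ /(_ (fun=> 1)); case.
  split; first exact: bmeas_cst.
  by move=> g Gg; under eq_fun do rewrite mul1r; exact: LG.
by move=> _ /(_ _ G1); under eq_fun do rewrite !mulr1.
Qed.

End Determining.

(** * The torus and its characters *)

Section Torus.
Context (R : realType).

(* The torus is represented by the plane with the sigma-algebra generated by the trigonometric
   functions, all of whose sets are periodic; no reduction modulo [2 pi] is then needed. *)
Definition trig (p q : int) (a : R) (w : R * R) : R := cos (p%:~R * w.1 + q%:~R * w.2 + a).

Definition trigs : set (R * R -> R) := [set g | exists p q a, g = trig p q a].

Definition trig_levels : set (set (R * R)) :=
  [set A | exists2 g, trigs g & exists c : R, A = [set x | c < g x]].

Definition torus : measurableType _ := g_sigma_algebraType trig_levels.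

Lemma measurable_torus : @measurable _ torus = <<s trig_levels >>.
Proof. by []. Qed.

Lemma measurable_to_torus d (Y : measurableType d) (f : Y -> torus) :
  (forall g, trigs g -> measurable_fun setT (g \o f)) -> measurable_fun setT f.
Proof.
move=> mf; apply: (@measurability _ _ Y torus setT f trig_levels erefl) => _ [_ [g Gg [c ->]] <-].
have := mf g Gg measurableT _ (measurable_itv `]c, +oo[).
by congr measurable; apply/seteqP; split => x /=; rewrite in_itv/= andbT.
Qed.

Lemma measurable_trig p q a : measurable_fun setT (trig p q a : torus -> R).
Proof.
apply: (measurability _ (RGenOInfty.measurableE R)) => _ [_ [c ->] <-].
rewrite setTI; apply: sub_sigma_algebra; exists (trig p q a); first by exists p, q, a.
by exists c; apply/seteqP; split => x /=; rewrite in_itv/= andbT.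
Qed.

Lemma norm_trig p q a w : `|trig p q a w| <= 1.
Proof. by rewrite ler_norml cos_geN1 cos_le1. Qed.

Lemma bmeas_trig p q a : @bmeas R _ torus (trig p q a).
Proof. by split; [exact: measurable_trig | exists 1; exact: norm_trig]. Qed.

Lemma trigM p q a p' q' a' w : trig p q a w * trig p' q' a' w =
  2^-1 * (trig (p + p') (q + q') (a + a') w + trig (p - p') (q - q') (a - a') w).
Proof.
rewrite /trig !rmorphD !rmorphN /=.
set u := p%:~R * w.1 + q%:~R * w.2 + a; set v := p'%:~R * w.1 + q'%:~R * w.2 + a'.
have -> : (p%:~R + p'%:~R) * w.1 + (q%:~R + q'%:~R) * w.2 + (a + a') = u + v by rewrite /u /v; ring.
have -> : (p%:~R - p'%:~R) * w.1 + (q%:~R - q'%:~R) * w.2 + (a - a') = u - v by rewrite /u /v; ring.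
by clearbody u v; rewrite cosB cosD; field.
Qed.

Lemma trigs1 : trigs (fun=> 1).
Proof. by exists 0, 0, 0; apply/funext => w; rewrite /trig !mul0r !addr0 cos0. Qed.

(** Serves both to compare two integrals, with [L] their difference, and to show that a function
    orthogonal to all [trig] vanishes, with [L] the integral against it. *)
Lemma torus_determining (L : (torus -> R) -> R) :
  (forall f g, bmeas f -> bmeas g -> L (fun x => f x + g x) = L f + L g) ->
  (forall a f, bmeas f -> L (fun x => a * f x) = a * L f) ->
  (forall u f, blim u f -> (fun n => L (u n)) @ \oo --> L f) ->
  (forall p q a, L (trig p q a) = 0) ->
  forall A : set torus, measurable A -> L (\1_A) = 0.
Proof.
move=> LD LZ Llim Ltrig A mA.
apply: (@determining R _ torus trigs L measurable_torus) => //.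
- by move=> _ [p [q [a ->]]]; exact: measurable_trig.
- by move=> _ [p [q [a ->]]]; exact: norm_trig.
- exact: trigs1.
- move=> _ _ [p [q [a ->]]] [p' [q' [a' ->]]].
  exists (trig (p + p') (q + q') (a + a')), (trig (p - p') (q - q') (a - a')); split.
  + by exists (p + p'), (q + q'), (a + a').
  + by exists (p - p'), (q - q'), (a - a').
  + exact: trigM.
- by move=> _ [p [q [a ->]]].
Qed.

Lemma pi2_gt0 : 0 < pi *+ 2 :> R.
Proof. by rewrite mulrn_wgt0// pi_gt0. Qed.

Local Notation U := (uniform_prob pi2_gt0).

Lemma sinD_int2pi (p : int) (a : R) : sin (p%:~R * (pi *+ 2) + a) = sin a.
Proof.
have H n (b : R) : sin (b + n%:R * (pi *+ 2)) = sin b.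
  by rewrite mulr_natl (periodicn (@sinD2pi R)).
case: p => n; first by rewrite addrC -pmulrn H.
by rewrite NegzE mulrNz mulNr addrC -[in RHS](subrK (n.+1%:R * (pi *+ 2)) a) H -pmulrn.
Qed.

Lemma continuous_cos_affine (c a : R) : continuous (fun x : R => cos (c * x + a)).
Proof.
move=> x; apply: (@continuous_comp _ _ _ (fun x => c * x + a) cos); last exact: continuous_cos.
by apply: cvgD; [apply: cvgM; [exact: cvg_cst | exact: cvg_id] | exact: cvg_cst].
Qed.

Lemma uniform_cos (p : int) (a : R) : p != 0 ->
  Rintegral U setT (fun x => cos (p%:~R * x + a)) = 0.
Proof.
move=> p0; have pR : p%:~R != 0 :> R by rewrite intr_eq0.
(* The formula [integral_uniform] asks for a nonnegative integrand, hence the added 1. *)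
pose f x : R := cos (p%:~R * x + a); pose g x := 1 + f x.
have mf : measurable_fun setT f.
  by apply: continuous_measurable_fun; exact: continuous_cos_affine.
have bf : bmeas f by split => //; exists 1 => x; rewrite ler_norml cos_geN1 cos_le1.
suff : Rintegral U setT g = 1.
  rewrite bintegralD//; last exact: bmeas_cst.
  by rewrite bintegral_cst => /(canRL (addKr _)); rewrite addNr.
have cf : continuous f := @continuous_cos_affine _ _.
pose F (x : R) := x + (p%:~R)^-1 * sin (p%:~R * x + a).
have dF (x : R) : is_derive x 1 F (g x).
  have h1 : is_derive x 1 (p%:~R *: @id R + cst a) (p%:~R *: 1 + 0) by exact: is_deriveD.
  have h2 := is_derive1_comp (is_derive_sin _) h1.
  have h3 := is_deriveD (is_derive_id x (1 : R)) (is_deriveZ (p%:~R)^-1 h2).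
  have := h3; congr is_derive; rewrite /g /f /=.
  rewrite addr0; change (1 + (p%:~R)^-1 * (cos (p%:~R * x + a) * (p%:~R * 1)) = 1 + cos (p%:~R * x + a)).
  by field.
have cF : continuous F by move=> x; apply/differentiable_continuous/derivable1_diffP; case: (dF x).
rewrite /Rintegral integral_uniform; last 2 first.
- by apply/measurable_EFinP; exact: measurable_funD.
- by move=> x; rewrite lee_fin /g /f; have := cos_geN1 (p%:~R * x + a); lra.
rewrite (@continuous_FTC2 _ _ F) ?pi2_gt0//; first last.
- by move=> x _; rewrite derive1E; case: (dF x).
- split; [by move=> x _; case: (dF x) | exact/cvg_at_right_filter/cF | exact/cvg_at_left_filter/cF].
- by apply: continuous_subspaceT => x; apply: cvgD; [exact: cvg_cst | exact: cf].
rewrite subr0 /F sinD_int2pi mulr0 !add0r -EFinB -EFinM /= addrK.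
by rewrite mulVf// gt_eqF// pi2_gt0.
Qed.

(** The identity, read as a map from the Borel plane to the sigma-algebra of periodic sets. Pushing
    the uniform law of a square of side 2 pi through it gives Haar measure. *)
Definition to_torus (w : measurableTypeR R * measurableTypeR R) : torus := w.

Lemma measurable_to_torus_id : measurable_fun setT to_torus.
Proof.
apply: measurable_to_torus => _ [p [q [a ->]]].
apply: (@measurableT_comp _ _ _ _ _ _ cos) => /=.
  by apply: continuous_measurable_fun; exact: continuous_cos.
apply: measurable_funD => //; apply: measurable_funD.
  by apply: measurable_funM; [exact: measurable_cst | exact: measurable_fst].
by apply: measurable_funM; [exact: measurable_cst | exact: measurable_snd].
Qed.

HB.instance Definition _ := isMeasurableFun.Build _ _ _ _ to_torus measurable_to_torus_id.

Definition haar : probability torus R := distribution (U \x U)%E to_torus.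

Lemma haar_trig p q a : Rintegral haar setT (trig p q a) = if (p == 0) && (q == 0) then cos a else 0.
Proof.
case: ifPn => [/andP[/eqP -> /eqP ->]|pq].
  rewrite (_ : trig _ _ _ = (fun=> cos a)); first exact: bintegral_cst.
  by apply/funext => w; rewrite /trig !mul0r !add0r.
have bt p' : @bmeas R _ (measurableTypeR R * measurableTypeR R)%type (trig p' q a).
  split; last by exists 1 => w; exact: norm_trig.
  exact: (measurableT_comp (measurable_trig p' q a) measurable_to_torus_id).
have E : (\int[(U \x U)%E]_w (trig p q a w)%:E)%E = 0%E.
  have bcos (c b : R) : bmeas (fun x : R => cos (c * x + b)).
    split; last by exists 1 => x; rewrite ler_norml cos_geN1 cos_le1.
    by apply: continuous_measurable_fun; exact: continuous_cos_affine.
  (* By Fubini it is enough to integrate first in a variable whose frequency is nonzero. *)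
  case: (eqVneq p 0) pq => [->|p0 _] /=.
    move=> q0; rewrite -integral12_prod_meas1; last exact: (bmeas_integrable (U \x U)%E (bt _)).
    apply: integral0_eq => s _; rewrite /fubini_F /trig /=.
    rewrite (_ : (fun t => _) = (fun t : R => (cos (q%:~R * t + (0 * s + a)))%:E)).
      exact: (etrans (bintegralE U (bcos _ _)) (congr1 EFin (uniform_cos _ q0))).
    by apply/funext => t; rewrite addrCA addrA.
  rewrite -integral21_prod_meas1; last exact: (bmeas_integrable (U \x U)%E (bt _)).
  apply: integral0_eq => t _; rewrite /fubini_G /trig /=.
  rewrite (_ : (fun s => _) = (fun s : R => (cos (p%:~R * s + (q%:~R * t + a)))%:E)).
    exact: (etrans (bintegralE U (bcos _ _)) (congr1 EFin (uniform_cos _ p0))).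
  by apply/funext => s; rewrite addrA.
rewrite /Rintegral integral_pushforward //=.
- by rewrite E.
- by apply/measurable_EFinP; exact: measurable_trig.
- exact: (bmeas_integrable (U \x U)%E (bt _)).
Qed.

End Torus.

(** * Fourier series on the torus *)

Section ComplexPlane.
Context (R : realType).
Implicit Types (z w : R[i]) (x y : R).

Definition cis x : R[i] := Complex (cos x) (sin x).

Lemma complexP z w : complex.Re z = complex.Re w -> complex.Im z = complex.Im w -> z = w.
Proof. by case: z => a b; case: w => c d /= -> ->. Qed.

Lemma Re_add z w : complex.Re (z + w) = complex.Re z + complex.Re w.
Proof. by case: z => a b; case: w. Qed.

Lemma Im_add z w : complex.Im (z + w) = complex.Im z + complex.Im w.
Proof. by case: z => a b; case: w. Qed.

Lemma Re_mul z w : complex.Re (z * w) = complex.Re z * complex.Re w - complex.Im z * complex.Im w.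
Proof. by case: z => a b; case: w. Qed.

Lemma Im_mul z w : complex.Im (z * w) = complex.Re z * complex.Im w + complex.Im z * complex.Re w.
Proof. by case: z => a b; case: w. Qed.

Lemma cconjM z w : cconj (z * w) = cconj z * cconj w.
Proof. by apply: complexP; rewrite /cconj /= ?Re_mul ?Im_mul /= ; ring. Qed.

Lemma sqmodM z w : sqmod (z * w) = sqmod z * sqmod w.
Proof. by rewrite /sqmod Re_mul Im_mul; ring. Qed.

Lemma sqmod_ge0 z : 0 <= sqmod z.
Proof. by rewrite /sqmod addr_ge0// sqr_ge0. Qed.

Lemma sqmod_eq0 z : sqmod z = 0 -> z = 0.
Proof.
move=> /eqP; rewrite /sqmod paddr_eq0 ?sqr_ge0// !sqrf_eq0 => /andP[/eqP a /eqP b].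
exact: complexP.
Qed.

Lemma cconj_sqmod z : sqmod (cconj z) = sqmod z.
Proof. by rewrite /sqmod /= sqrrN. Qed.

Lemma mul_cconj z : sqmod z = 1 -> z * cconj z = 1.
Proof.
rewrite /sqmod => h; apply: complexP; rewrite ?Re_mul ?Im_mul /=; last by ring.
by rewrite mulrN opprK -!expr2.
Qed.

Lemma cisD x y : cis (x + y) = cis x * cis y.
Proof. by apply: complexP; rewrite ?Re_mul ?Im_mul /= ?cosD ?sinD//; ring. Qed.

Lemma cis0 : cis 0 = 1.
Proof. by rewrite /cis cos0 sin0. Qed.

Lemma cisN x : cis (- x) = cconj (cis x).
Proof. by rewrite /cis cosN sinN. Qed.

Lemma cis_sqmod x : sqmod (cis x) = 1.
Proof. exact: cos2Dsin2. Qed.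

Lemma cisNK x : cis (- x) * cis x = 1.
Proof. by rewrite -cisD addNr cis0. Qed.

End ComplexPlane.

Section ComplexIntegral.
Context (R : realType) (d : measure_display) (Y : measurableType d).
Implicit Types (F G : Y -> R[i]) (c : R[i]).

Definition cbmeas F := bmeas (fun x => complex.Re (F x)) /\ bmeas (fun x => complex.Im (F x)).

Lemma cbmeasM F G : cbmeas F -> cbmeas G -> cbmeas (fun x => F x * G x).
Proof.
move=> [F1 F2] [G1 G2]; split.
  by under eq_fun do rewrite Re_mul; apply: bmeasB; exact: bmeasM.
by under eq_fun do rewrite Im_mul; apply: bmeasD; exact: bmeasM.
Qed.

Lemma cbmeasD F G : cbmeas F -> cbmeas G -> cbmeas (fun x => F x + G x).
Proof.
move=> [F1 F2] [G1 G2]; split.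
  by under eq_fun do rewrite Re_add; exact: bmeasD.
by under eq_fun do rewrite Im_add; exact: bmeasD.
Qed.

Lemma cbmeas_cst c : cbmeas (fun=> c).
Proof. by split; exact: bmeas_cst. Qed.

Lemma cbmeasZ c F : cbmeas F -> cbmeas (fun x => c * F x).
Proof. exact: cbmeasM (cbmeas_cst c). Qed.

Lemma bmeas_sqmod F : cbmeas F -> bmeas (fun x => sqmod (F x)).
Proof.
move=> [F1 F2]; rewrite /sqmod; under eq_fun do rewrite !expr2.
by apply: bmeasD; exact: bmeasM.
Qed.

Variable P : probability Y R.

Definition cint F : R[i] := Complex
  (Rintegral P setT (fun x => complex.Re (F x))) (Rintegral P setT (fun x => complex.Im (F x))).

Lemma cintD F G : cbmeas F -> cbmeas G -> cint (fun x => F x + G x) = cint F + cint G.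
Proof.
move=> [F1 F2] [G1 G2]; apply: complexP; rewrite ?Re_add ?Im_add /= -bintegralD//.
  by under eq_Rintegral do rewrite Re_add.
by under eq_Rintegral do rewrite Im_add.
Qed.

Lemma cintZ c F : cbmeas F -> cint (fun x => c * F x) = c * cint F.
Proof.
move=> [F1 F2]; apply: complexP; rewrite ?Re_mul ?Im_mul /= -!bintegralZ//.
  by under eq_Rintegral do rewrite Re_mul; rewrite bintegralB//; exact: bmeasZ.
by under eq_Rintegral do rewrite Im_mul; rewrite bintegralD//; exact: bmeasZ.
Qed.

Lemma cint_ae F G : cbmeas F -> cbmeas G -> {ae P, forall x, F x = G x} -> cint F = cint G.
Proof.
by move=> [F1 F2] [G1 G2] FG; apply: complexP => /=; apply: bintegral_ae => //;
  apply: filterS FG => x /= ->.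
Qed.

Lemma bintegral_preserved (T : Y -> Y) (f : Y -> R) : measure_preserving P T -> bmeas f ->
  bmeas (f \o T) /\ Rintegral P setT (f \o T) = Rintegral P setT f.
Proof.
move=> [mT PT] bf; have bfT : bmeas (f \o T).
  by split; [exact: measurableT_comp bf.1 mT | case: bf => _ [M hM]; exists M => x /=].
split=> //; rewrite /Rintegral; congr fine.
have := @integral_pushforward _ _ _ _ _ T mT P setT (fun x => (f x)%:E) _ _ measurableT.
rewrite preimage_setT => <-.
- by apply: eq_measure_integral => A mA _; exact: PT.
- by apply/measurable_EFinP; case: bf.
- exact: (bmeas_integrable P bfT).
Qed.

Lemma cint_preserved (T : Y -> Y) F : measure_preserving P T -> cbmeas F ->
  cbmeas (F \o T) /\ cint (F \o T) = cint F.
Proof.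
move=> PT [F1 F2]; have [b1 i1] := bintegral_preserved PT F1.
have [b2 i2] := bintegral_preserved PT F2.
by split; [split | apply: complexP].
Qed.

Lemma bintegral_abs_eq0 (f : Y -> R) : bmeas f -> Rintegral P setT (fun x => `|f x|) = 0 ->
  {ae P, forall x, f x = 0}.
Proof.
move=> bf f0; have bn : bmeas (fun x => `|f x|).
  case: bf => mf [M hM]; split; first exact: measurableT_comp.
  by exists M => x; rewrite normr_id.
have := @ae_eq_integral_abs _ _ _ P setT measurableT (EFin \o f).
case; first by apply/measurable_EFinP; case: bf.
move=> + _; case.
  by have := bintegralE P bn; rewrite f0.
move=> N [mN N0 sN]; exists N; split=> // x /= fx; apply: sN => /= h.
by apply: fx; have [] := h I.
Qed.

End ComplexIntegral.

(** * Characters, Bessel's inequality and uniqueness of Fourier coefficients *)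

Section Fourier.
Context (R : realType).
Local Notation torus := (torus R).
Local Notation haar := (haar R).
Local Notation cint := (cint haar).
Implicit Types (F : torus -> R[i]) (p q : int).

Definition char p q (w : torus) : R[i] := cis (p%:~R * w.1 + q%:~R * w.2).

Lemma char_Re p q w : complex.Re (char p q w) = trig p q 0 w.
Proof. by rewrite /trig addr0. Qed.

(** The phase argument of [trig] lets one family contain sines as well as cosines. *)
Lemma char_Im p q w : complex.Im (char p q w) = trig p q (- (pi / 2)) w.
Proof. by rewrite /trig cosBpihalf. Qed.

Lemma cbmeas_char p q : cbmeas (char p q).
Proof.
split; first by under eq_fun do rewrite char_Re; exact: bmeas_trig.
by under eq_fun do rewrite char_Im; exact: bmeas_trig.
Qed.

Lemma charD p q p' q' w : char (p + p') (q + q') w = char p q w * char p' q' w.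
Proof. by rewrite -cisD /char; congr cis; rewrite !rmorphD/=; ring. Qed.

Lemma charN p q w : char (- p) (- q) w = cconj (char p q w).
Proof. by rewrite -cisN /char; congr cis; rewrite !rmorphN/=; ring. Qed.

Lemma char0 w : char 0 0 w = 1.
Proof. by rewrite /char !mul0r addr0 cis0. Qed.

Lemma char_sqmod p q w : sqmod (char p q w) = 1.
Proof. exact: cis_sqmod. Qed.

Lemma cint_char p q : cint (char p q) = ((p == 0) && (q == 0))%:R.
Proof.
have -> : cint (char p q) = Complex (Rintegral haar setT (trig p q 0))
    (Rintegral haar setT (trig p q (- (pi / 2)))).
  by congr Complex; apply: eq_Rintegral => w _; [exact: char_Re | exact: char_Im].
by rewrite !haar_trig cos0 cosN cos_pihalf; case: ifP.
Qed.

Definition coef F p q : R[i] := cint (fun w => F w * char (- p) (- q) w).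

Lemma coef_char p q p' q' : coef (char p q) p' q' = ((p == p') && (q == q'))%:R.
Proof.
rewrite /coef; under eq_fun do rewrite -charD.
by rewrite cint_char !subr_eq0.
Qed.

Lemma coefB_char F p q c p' q' : cbmeas F ->
  coef (fun w => F w - c * char p q w) p' q' = coef F p' q' - c * ((p == p') && (q == q'))%:R.
Proof.
move=> bF; rewrite -coef_char /coef -mulNr -cintZ; last first.
  exact: cbmeasM (cbmeas_char _ _) (cbmeas_char _ _).
rewrite -cintD.
- by congr cint; apply/funext => w; ring.
- exact: cbmeasM bF (cbmeas_char _ _).
- exact: cbmeasZ (cbmeasM (cbmeas_char _ _) (cbmeas_char _ _)).
Qed.

Lemma cbmeasB_char F c p q : cbmeas F -> cbmeas (fun w => F w - c * char p q w).
Proof.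
move=> bF; under eq_fun do rewrite -mulNr.
exact: cbmeasD bF (cbmeasZ _ (cbmeas_char _ _)).
Qed.

(** Pythagoras: expand the square with |char| = 1; the cross term integrates to twice the squared
    modulus of the coefficient. *)
Lemma residual_norm F p q : cbmeas F ->
  Rintegral haar setT (fun w => sqmod (F w - coef F p q * char p q w)) =
  Rintegral haar setT (fun w => sqmod (F w)) - sqmod (coef F p q).
Proof.
move=> bF; set a := coef F p q.
have bG : cbmeas (fun w => F w * char (- p) (- q) w) by exact: cbmeasM bF (cbmeas_char _ _).
have bH := cbmeasZ (cconj a) bG.
rewrite (_ : (fun w => sqmod (F w - _)) = (fun w => (sqmod (F w) + sqmod a) -
    2 * complex.Re (cconj a * (F w * char (- p) (- q) w)))).
  have b1 := bmeas_sqmod bF.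
  have b2 := bmeasD b1 (bmeas_cst torus (sqmod a)).
  rewrite (bintegralB _ b2 (bmeasZ 2 bH.1)) (bintegralD _ b1 (bmeas_cst torus (sqmod a))).
  rewrite bintegral_cst (bintegralZ _ 2 bH.1).
  have -> : Rintegral haar setT (fun w => complex.Re (cconj a * (F w * char (- p) (- q) w))) =
      complex.Re (cconj a * a) by rewrite -[X in _ * X]/(coef F p q) /coef -cintZ.
  by rewrite Re_mul /sqmod /=; ring.
apply/funext => w; rewrite charN {bH}.
have := char_sqmod p q w; rewrite /sqmod.
case: (F w) => x y; case: (char p q w) => u v; case: a => s t /= h.
have -> : s ^+ 2 + t ^+ 2 = (s ^+ 2 + t ^+ 2) * (u ^+ 2 + v ^+ 2) by rewrite h mulr1.
by ring.
Qed.

(** Induction on [s]: subtracting the first component lowers the norm by exactly its share and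
    leaves the coefficients at the other frequencies unchanged. *)
Lemma bessel F (s : seq (int * int)) : cbmeas F -> uniq s ->
  \sum_(k <- s) sqmod (coef F k.1 k.2) <= Rintegral haar setT (fun w => sqmod (F w)).
Proof.
elim: s F => [|[p q] s IH] F bF /=.
  by rewrite big_nil => _; apply: Rintegral_ge0 => w _; exact: sqmod_ge0.
move=> /andP[pqs us]; rewrite big_cons /= addrC -lerBrDr -residual_norm//.
apply: le_trans (IH _ _ us); last exact: cbmeasB_char.
rewrite big_seq [leRHS]big_seq; apply: ler_sum => -[p' q'] k's /=.
rewrite coefB_char// [(_ && _)](_ : _ = false) ?mulr0 ?subr0//.
by apply: contraNF pqs => /andP[/eqP -> /eqP ->].
Qed.

Lemma fourier_unique_real (f : torus -> R) : bmeas f ->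
  (forall p q a, Rintegral haar setT (fun w => f w * trig p q a w) = 0) ->
  {ae haar, forall w, f w = 0}.
Proof.
move=> bf f0.
have ind (A : set torus) : measurable A -> Rintegral haar setT (fun w => f w * \1_A w) = 0.
  apply: (torus_determining (L := fun g => Rintegral haar setT (fun w => f w * g w))) => //.
  - move=> g h bg bh; under eq_Rintegral do rewrite mulrDr.
    by rewrite bintegralD//; exact: bmeasM.
  - move=> a g bg; under eq_Rintegral do rewrite mulrCA.
    by rewrite bintegralZ//; exact: bmeasM.
  - move=> u g ug; apply: bintegral_lim.
    by have := blimM ug bf; congr blim; [apply/funext => n|]; apply/funext => w; rewrite mulrC.
apply: bintegral_abs_eq0 => //.
pose A := [set w : torus | 0 < f w].
have mA : measurable A.
  have := bf.1 measurableT _ (measurable_itv `]0, +oo[).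
  by rewrite setTI; congr measurable; apply/seteqP; split => x /=; rewrite in_itv/= andbT.
have bA := bmeasM bf (bmeas_indic R mA).
(* With [A] the set where [f] is positive, |f| is a combination of [f] restricted to measurable
   sets, whose integrals vanish by [ind]. *)
rewrite (_ : (fun w => `|f w|) = (fun w => 2 * (f w * \1_A w) - f w * \1_(@setT torus) w)).
  rewrite bintegralB ?bintegralZ ?ind//; first by rewrite mulr0 subr0.
  - exact: bmeasZ.
  - by apply: bmeasM => //; exact: bmeas_indic.
apply/funext => w; rewrite !indicE in_setT mulr1.
have [w0|w0] := ltP 0 (f w).
  by rewrite mem_set//= gtr0_norm//; ring.
by rewrite memNset/= ?ler0_norm//; [ring | apply/negP; rewrite -leNgt].
Qed.

Lemma fourier_unique F : cbmeas F -> (forall p q, coef F p q = 0) ->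
  {ae haar, forall w, F w = 0}.
Proof.
move=> bF F0.
have H p q (c : R[i]) : cint (fun w => F w * (c * char p q w)) = 0.
  have := F0 (- p) (- q); rewrite /coef !opprK => h.
  under eq_fun do rewrite mulrCA.
  by rewrite cintZ ?h ?mulr0//; exact: cbmeasM bF (cbmeas_char _ _).
(* [trig p q a] is the average of [cis a * char p q] and its conjugate. *)
have H2 p q a : cint (fun w => F w * Complex (trig p q a w) 0) = 0.
  rewrite (_ : (fun w => _) = (fun w => F w * (Complex 2^-1 0 * cis a * char p q w) +
      F w * (Complex 2^-1 0 * cis (- a) * char (- p) (- q) w))).
    by rewrite cintD ?H ?addr0//; apply: cbmeasM => //; apply: cbmeasZ; exact: cbmeas_char.
  apply/funext => w; rewrite -mulrDr; congr (_ * _).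
  rewrite -!mulrA charN cisN -cconjM [cis a * _](_ : _ = cis (p%:~R * w.1 + q%:~R * w.2 + a)).
    by apply: complexP; rewrite ?Re_add ?Im_add !(Re_mul, Im_mul) /trig /=; field.
  by rewrite -cisD addrC.
have [F1 F2] := bF.
have Z1 := @fourier_unique_real _ F1.
have Z2 := @fourier_unique_real _ F2.
have {}Z1 : {ae haar, forall w, complex.Re (F w) = 0}.
  apply: Z1 => p q a; have := congr1 (@complex.Re R) (H2 p q a) => /= <-.
  by apply: eq_Rintegral => w _; rewrite Re_mul /= mulr0 subr0.
have {}Z2 : {ae haar, forall w, complex.Im (F w) = 0}.
  apply: Z2 => p q a; have := congr1 (@complex.Im R) (H2 p q a) => /= <-.
  by apply: eq_Rintegral => w _; rewrite Im_mul /= mulr0 add0r.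
by apply: filterS2 Z1 Z2 => w z1 z2; exact: complexP.
Qed.

End Fourier.

(** * Rigidity of the skew shift *)

Section AlmostEverywhere.
Context (R : realType) (d : measure_display) (Y : measurableType d) (P : probability Y R).

Lemma ae_exists (Q : Y -> Prop) : {ae P, forall x, Q x} -> exists x, Q x.
Proof.
move=> [N [mN N0 QN]]; apply: contrapT => nQ.
have NT : N = setT by rewrite -subTset => x _; apply: QN => Qx; apply: nQ; exists x.
by move: N0; rewrite NT probability_setT => /eqP; rewrite onee_eq0.
Qed.

Lemma ae_and (Q Q' : Y -> Prop) : {ae P, forall x, Q x} -> {ae P, forall x, Q' x} ->
  {ae P, forall x, Q x /\ Q' x}.
Proof. exact: filterS2. Qed.

End AlmostEverywhere.

Section Skew.
Context (R : realType).
Local Notation torus := (torus R).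
Local Notation haar := (haar R).

(** Chosen so that [cis beta] is (3 + 4i) / 5, a point of the unit circle that is not a root of
    unity for elementary arithmetic reasons. *)
Definition beta : R := acos (3 / 5).

Lemma cos_beta : cos beta = 3 / 5.
Proof. by rewrite /beta acosK// in_itv/=; apply/andP; split; lra. Qed.

Lemma sin_beta : sin beta = 4 / 5.
Proof.
rewrite /beta sin_acos; last by apply/andP; split; lra.
rewrite (_ : 1 - _ = (4 / 5) ^+ 2); last by field.
by rewrite sqrtr_sqr ger0_norm//; lra.
Qed.

(* [(3 + 4i)^2 = -7 + 24i] is congruent to [3 + 4i] modulo 5, so all the powers of [3 + 4i] are. *)
Lemma beta_mod5 n : exists j k : int,
  5 ^+ n.+1 * cos (n.+1%:R * beta) = (5 * j + 3)%:~R /\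
  5 ^+ n.+1 * sin (n.+1%:R * beta) = (5 * k + 4)%:~R.
Proof.
elim: n => [|n [j [k [hc hs]]]].
  by exists 0, 0; rewrite mul1r cos_beta sin_beta !expr1; split; rewrite mulr0 add0r; field.
exists (3 * j - 4 * k - 2), (3 * k + 4 * j + 4).
have -> : n.+2%:R * beta = n.+1%:R * beta + beta by rewrite -[n.+2]addn1 natrD; ring.
rewrite cosD sinD cos_beta sin_beta exprS.
set u := 5 ^+ n.+1 in hc hs *; set x := cos _ in hc hs *; set y := sin _ in hc hs *.
have -> : 5 * u * (x * (3 / 5) - y * (4 / 5)) = 3 * (u * x) - 4 * (u * y) by field.
have -> : 5 * u * (y * (3 / 5) + x * (4 / 5)) = 3 * (u * y) + 4 * (u * x) by field.
by rewrite hc hs; split; ring.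
Qed.

(** For n > 0 the integer 5^n sin(n beta) is 4 modulo 5, hence nonzero; negative [p] follow by
    oddness. *)
Lemma cis_beta_eq1 (p : int) : cis (p%:~R * beta) = 1 -> p = 0.
Proof.
have H n : sin (n.+1%:R * beta) != 0.
  have [j [k [_ h]]] := beta_mod5 n; apply/eqP => s0.
  move: h; rewrite s0 mulr0 => /esym/eqP; rewrite intr_eq0 => /eqP.
  by lia.
case: p => [[|n]|n] // h.
  by have := H n; have := congr1 (@complex.Im R) h; rewrite /= => ->; rewrite eqxx.
have := H n; have := congr1 (@complex.Im R) h.
by rewrite /= NegzE mulrNz mulNr sinN => /eqP; rewrite oppr_eq0 => /eqP ->; rewrite eqxx.
Qed.

Definition skew_shift (w : torus) : torus := (w.1 + beta, w.2 + w.1).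

Lemma trig_skew p q a w : trig p q a (skew_shift w) = trig (p + q) q (a + p%:~R * beta) w.
Proof. by rewrite /trig /=; congr cos; rewrite rmorphD /=; ring. Qed.

Lemma char_skew p q w : char p q (skew_shift w) = cis (p%:~R * beta) * char (p + q) q w.
Proof. by rewrite -cisD /char /=; congr cis; rewrite rmorphD /=; ring. Qed.

Lemma measurable_skew : measurable_fun setT skew_shift.
Proof.
apply: measurable_to_torus => _ [p [q [a ->]]].
rewrite (_ : _ \o _ = trig (p + q) q (a + p%:~R * beta)); first exact: measurable_trig.
by apply/funext => w; exact: trig_skew.
Qed.

Lemma bmeas_skew (f : torus -> R) : bmeas f -> bmeas (f \o skew_shift).
Proof.
move=> [mf [M hM]]; split; first exact: measurableT_comp mf measurable_skew.
by exists M => w; exact: hM.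
Qed.

Lemma skew_preserves : measure_preserving haar skew_shift.
Proof.
split; first exact: measurable_skew.
move=> A mA; have mSA : measurable (skew_shift @^-1` A).
  by rewrite -[X in measurable X]setTI; exact: measurable_skew.
(* The shift sends frequency (p, q) to (p + q, q), which is zero only if (p, q) is, and the phase it
   adds vanishes when p = 0. So [L] kills every [trig]. *)
pose L (g : torus -> R) := Rintegral haar setT (g \o skew_shift) - Rintegral haar setT g.
have : L (\1_A) = 0.
  apply: torus_determining => //.
  - move=> f g bf bg; rewrite /L.
    by rewrite bintegralD// (bintegralD _ (bmeas_skew bf) (bmeas_skew bg)); ring.
  - by move=> a f bf; rewrite /L bintegralZ// (bintegralZ _ a (bmeas_skew bf)); ring.
  - move=> u f uf; apply: cvgB; last exact: bintegral_lim.
    apply: (@bintegral_lim _ _ _ haar (fun n => u n \o skew_shift)).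
    case: uf => mu [M hM] cu; split.
    + by move=> n; exact: measurableT_comp (mu n) measurable_skew.
    + by exists M => n w; exact: hM.
    + by move=> w; exact: cu.
  - move=> p q a; rewrite /L (_ : _ \o _ = trig (p + q) q (a + p%:~R * beta)).
      rewrite !haar_trig; have [->|q0] := eqVneq q 0; last by rewrite !andbF subrr.
      by rewrite addr0; have [->|p0] := eqVneq p 0; rewrite /= ?mul0r ?addr0 subrr.
    by apply/funext => w; exact: trig_skew.
move=> /subr0_eq hI.
have hP : fine (haar (skew_shift @^-1` A)) = fine (haar A).
  by rewrite -(bintegral_indic haar mSA) -(bintegral_indic haar mA) -hI.
by rewrite -[LHS]fineK ?fin_num_measure// hP fineK// fin_num_measure.
Qed.

Section Rigidity.
Variables (F : torus -> R[i]) (c : R[i]) (a b : int).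
Hypothesis bF : cbmeas F.
Hypothesis c1 : sqmod c = 1.
Hypothesis FS : {ae haar, forall w, F (skew_shift w) = c * char a b w * F w}.

(** Invariance of [haar] lets the integrand be composed with the shift, which turns characters into
    multiples of characters; [FS] then removes the shift from [F]. *)
Let coef_step p q : coef F p q = c * cis (- (p%:~R * beta)) * coef F (p + q - a) (q - b).
Proof.
have bH p' q' : cbmeas (fun w => F w * char p' q' w) by exact: cbmeasM bF (cbmeas_char R _ _).
have [bHS e] := cint_preserved skew_preserves (bH (- p) (- q)).
rewrite {1}/coef -e /coef -cintZ//.
apply: cint_ae => //; first exact: cbmeasZ.
apply: filterS FS => w /= ->.
rewrite char_skew rmorphN /= mulNr.
have -> : char (- (p + q - a)) (- (q - b)) w = char a b w * char (- p - q) (- q) w.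
  by rewrite -charD; congr char; ring.
by ring.
Qed.

Let step (k : int * int) : int * int := (k.1 + k.2 - a, k.2 - b).

Let coef_iter n k : sqmod (coef F (iter n step k).1 (iter n step k).2) = sqmod (coef F k.1 k.2).
Proof.
elim: n => // n <-; rewrite iterS /= [in RHS]coef_step.
by rewrite !sqmodM c1 cis_sqmod !mul1r.
Qed.

Let coef_inj k : injective (fun n => iter n step k) -> coef F k.1 k.2 = 0.
Proof.
move=> inj; apply: sqmod_eq0; set r := sqmod _.
(* An injective orbit supplies [N] distinct frequencies with the same squared modulus [r], for every
   [N]. *)
have H N : r *+ N <= Rintegral haar setT (fun w => sqmod (F w)).
  have := @bessel _ F [seq iter n step k | n <- iota 0 N] bF.
  rewrite map_inj_uniq// iota_uniq big_map => /(_ isT); apply: le_trans.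
  rewrite (eq_bigr (fun=> r)); last by move=> n _; exact: coef_iter.
  by rewrite big_const_seq count_predT size_iota iter_addr addr0.
apply/eqP; rewrite eq_le sqmod_ge0 andbT leNgt; apply/negP => r0.
set M := Rintegral _ _ _ in H.
have [N hN] : exists N : nat, M / r < N%:R.
  exists (Num.bound (M / r)); apply: archi_boundP; rewrite divr_ge0 ?(ltW r0)//.
  by have := H 0%N; rewrite mulr0n.
by have := H N; rewrite -mulr_natl leNgt -ltr_pdivrMr// hN.
Qed.

Let iter_snd n k : (iter n step k).2 = k.2 - n%:Z * b.
Proof. by elim: n => [|n IH]; [rewrite /=; ring | rewrite iterS /= IH -addn1 PoszD; ring]. Qed.

Let coef_b : b != 0 -> forall p q, coef F p q = 0.
Proof.
move=> b0 p q; apply: (@coef_inj (p, q)) => m n /(congr1 snd); rewrite !iter_snd => /addrI/oppr_inj.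
by move=> /(mulIf b0) [].
Qed.

(** When b = 0, [step] keeps q and moves p by q - a, so the orbit is infinite unless q = a. *)
Let coef_q : b = 0 -> forall p q, q != a -> coef F p q = 0.
Proof.
move=> b0 p q qa; apply: (@coef_inj (p, q)) => m n.
have E k : (iter k step (p, q)).1 = p + k%:Z * (q - a).
  elim: k => [|k IH]; first by rewrite /=; ring.
  by rewrite iterS /= IH iter_snd b0 /= -addn1 PoszD; ring.
move=> /(congr1 fst); rewrite !E => /addrI h.
have qa' : q - a != 0 by rewrite subr_eq0.
by case: (mulIf qa' h).
Qed.

(* The Fourier coefficients of [F] have constant modulus along the orbits of [step], so by Bessel's
   inequality they are supported on the finite orbits. *)
Lemma skew_rigidity : ~ {ae haar, forall w, F w = 0} ->
  b = 0 /\ exists C p, c = cis (p%:~R * beta) /\ {ae haar, forall w, F w = C * char p a w}.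
Proof.
move=> F0; have b0 : b = 0.
  by apply/eqP; apply: contra_notT F0 => b0; apply: fourier_unique => //; exact: coef_b.
split=> //.
have [p p0] : exists p, coef F p a != 0.
  apply: contra_notP F0 => h; apply: fourier_unique => // p q.
  have [->|qa] := eqVneq q a; last exact: coef_q.
  by apply: contrapT => /eqP pa; apply: h; exists p.
(* For b = 0 the frequency (p', a) is fixed by [step], so [coef_step] becomes an equation for [c].
   By [cis_beta_eq1] it can hold for one p' only, so a single coefficient survives. *)
have ev p' : coef F p' a != 0 -> c = cis (p'%:~R * beta).
  move=> h; have := coef_step p' a; rewrite b0 subr0 addrK -{1}[coef F p' a]mul1r.
  move=> /(mulIf h) e; rewrite -[LHS]mulr1 -(cisNK (p'%:~R * beta)) mulrA -e mul1r//.
exists (coef F p a), p; split; first exact: ev.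
have : {ae haar, forall w, F w - coef F p a * char p a w = 0}.
  apply: fourier_unique; first exact: cbmeasB_char.
  move=> p' q'; rewrite coefB_char//.
  have [<-|qa] := eqVneq a q'; last by rewrite andbF mulr0 subr0 coef_q// eq_sym.
  rewrite andbT; have [<-|pp] := eqVneq p p'; first by rewrite mulr1 subrr.
  rewrite mulr0 subr0; apply: contrapT => /eqP p'0.
  have := cisNK (p%:~R * beta); rewrite -(ev _ p0) (ev _ p'0) -cisD => h.
  have := @cis_beta_eq1 (p' - p); rewrite rmorphB /= mulrBl addrC h => /(_ erefl) /eqP.
  by rewrite subr_eq0 eq_sym (negbTE pp).
by apply: filterS => w /eqP; rewrite subr_eq0 => /eqP.
Qed.

End Rigidity.

(** Rigidity applies to the indicator of an invariant set with c = 1 and a = b = 0: the frequency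
    must be 0, so the indicator is almost everywhere constant. *)
Lemma skew_ergodic : ergodic haar skew_shift.
Proof.
move=> A mA SA; pose F w : R[i] := Complex (\1_A w) 0.
have bF : cbmeas F by split; [exact: bmeas_indic | exact: bmeas_cst].
have c1 : sqmod (1 : R[i]) = 1 by rewrite /sqmod /= expr0n addr0 expr1n.
have FS : {ae haar, forall w, F (skew_shift w) = 1 * char 0 0 w * F w}.
  by apply: aeW => w; rewrite char0 !mul1r /F -[in RHS]SA.
have PA : fine (haar A) = Rintegral haar setT (\1_A) by rewrite bintegral_indic.
have fA r : Rintegral haar setT (\1_A) = r -> haar A = r%:E.
  by rewrite -PA => <-; rewrite fineK// fin_num_measure.
have [F0|nF0] := pselect {ae haar, forall w, F w = 0}.
  left; apply: fA; rewrite -[RHS](bintegral_cst haar 0); apply: bintegral_ae.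
  - exact: bmeas_indic.
  - exact: bmeas_cst.
  - by apply: filterS F0 => w /(congr1 (@complex.Re R)).
have [_ [C [p [/esym/cis_beta_eq1 -> FC]]]] := skew_rigidity bF c1 FS nF0.
have {}FC : {ae haar, forall w, F w = C} by apply: filterS FC => w ->; rewrite char0 mulr1.
have [w hw] := ae_exists FC.
right; apply: fA; rewrite -[RHS](bintegral_cst haar 1); apply: bintegral_ae.
- exact: bmeas_indic.
- exact: bmeas_cst.
have C1 : C = 1.
  move: hw FC; rewrite /F indicE; by case: (w \in A) => /= <-.
by apply: filterS FC => x; rewrite C1 => /(congr1 (@complex.Re R)).
Qed.

End Skew.

(** * The two-sheeted system *)

Section TwoSheets.
Context (R : realType).
Local Notation torus := (torus R).
Local Notation haar := (haar R).
Local Notation X := (torus * bool)%type.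
Local Notation coin := (bernoulli_prob (2^-1 : R)).

Definition sheets : probability X R := (haar \x coin)%E.
Local Notation mu := sheets.

Lemma coin_integral (f : bool -> R) : Rintegral coin setT f = 2^-1 * (f false + f true).
Proof.
have bf : bmeas f.
  split; first by move=> _ A mA.
  exists (`|f false| + `|f true|) => -[]; rewrite ?lerDl ?lerDr//.
(* The Bernoulli integral formula is for nonnegative functions; the shift by [M] is cancelled
   afterwards. *)
pose M : R := `|f false| + `|f true|.
have M0 b : 0 <= f b + M.
  by rewrite /M; case: b; have := ler_norm (- f false); have := ler_norm (- f true);
    rewrite !normrN; have := normr_ge0 (f false); have := normr_ge0 (f true); lra.
have h01 : ((0 : R) <= 2^-1) && ((2^-1 : R) <= 1) by apply/andP; split; lra.
suff : Rintegral coin setT (fun b => f b + M) = 2^-1 * (f false + f true) + M.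
  by rewrite (bintegralD _ bf (bmeas_cst _ M)) bintegral_cst => /addIr.
rewrite /Rintegral (@integral_bernoulli_prob _ _ h01 (fun b => (f b + M)%:E)); last first.
  by move=> b; rewrite lee_fin.
by rewrite -!EFinM -EFinD /= /unstable.onem; field.
Qed.

Lemma bmeas_slice (f : X -> R) b : bmeas f -> bmeas (fun w => f (w, b)).
Proof.
move=> [mf [M hM]]; split; last by exists M => w; exact: hM.
exact: measurableT_comp mf (pair2_measurable b).
Qed.

Lemma sheets_integral (f : X -> R) : bmeas f -> Rintegral mu setT f =
  2^-1 * (Rintegral haar setT (fun w => f (w, false)) + Rintegral haar setT (fun w => f (w, true))).
Proof.
move=> bf; rewrite -bintegralD; [|exact: bmeas_slice|exact: bmeas_slice].
rewrite -bintegralZ; last by apply: bmeasD; exact: bmeas_slice.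
rewrite /Rintegral; congr fine.
rewrite -(integral12_prod_meas1 (bmeas_integrable mu bf)).
apply: eq_integral => w _; rewrite /fubini_F -(coin_integral (fun b => f (w, b))).
by apply: bintegralE; split; [move=> _ A mA | case: bf => _ [M hM]; exists M].
Qed.

Lemma measurable_slice (A : set X) b : measurable A -> measurable [set w | A (w, b)].
Proof.
by move=> mA; have := pair2_measurable b measurableT mA; rewrite setTI.
Qed.

Lemma fine_sheets (A : set X) : measurable A -> fine (mu A) =
  2^-1 * (fine (haar [set w | A (w, false)]) + fine (haar [set w | A (w, true)])).
Proof.
move=> mA; rewrite -bintegral_indic// sheets_integral; last exact: bmeas_indic.
have e b := bintegral_indic haar (measurable_slice b mA).
by congr (_ * (_ + _)); [exact: e false | exact: e true].
Qed.

Lemma half_sum_eq0 (x y : R) : 0 = 2^-1 * (x + y) -> 0 <= x -> 0 <= y -> x = 0 /\ y = 0.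
Proof. by move=> h x0 y0; split; lra. Qed.

(** Both sheets have mass 1/2, so a set is null exactly when its two slices are. *)
Lemma ae_sheets (Q : X -> Prop) :
  {ae mu, forall x, Q x} <-> forall b, {ae haar, forall w, Q (w, b)}.
Proof.
have fine0 d (Y : measurableType d) (P : probability Y R) (A : set Y) :
    measurable A -> fine (P A) = 0 -> P A = 0%E.
  by move=> mA h; rewrite -[LHS]fineK ?fin_num_measure// h.
split.
  move=> [N [mN N0 QN]] b; have := fine_sheets mN; rewrite N0 /= => h.
  have h0 := fine_ge0 (measure_ge0 haar [set w | N (w, false)]).
  have h1 := fine_ge0 (measure_ge0 haar [set w | N (w, true)]).
  have [z0 z1] : fine (haar [set w | N (w, false)]) = 0 /\ fine (haar [set w | N (w, true)]) = 0.
    exact: half_sum_eq0 h h0 h1.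
  exists [set w | N (w, b)]; split; first exact: measurable_slice.
    by apply: fine0; [exact: measurable_slice | case: b; [exact: z1 | exact: z0]].
  by move=> w /= nQ; exact: QN.
move=> H; have [N0 [mN0 N00 QN0]] := H false; have [N1 [mN1 N10 QN1]] := H true.
have mN : measurable (N0 `*` [set false] `|` N1 `*` [set true] : set X).
  by apply: measurableU; apply: measurableX.
exists (N0 `*` [set false] `|` N1 `*` [set true]); split => //.
  apply: fine0 => //; rewrite fine_sheets//.
  rewrite (_ : [set w | _ (w, false)] = N0); last first.
    by apply/seteqP; split => w /= => [[[]|[]]//|?]; left.
  rewrite (_ : [set w | _ (w, true)] = N1); last first.
    by apply/seteqP; split => w /= => [[[]|[]]//|?]; right.
  by rewrite [haar N0]N00 [haar N1]N10 /= addr0 mulr0.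
by move=> [w []] /= nQ; [right; split=> //; exact: QN1 | left; split=> //; exact: QN0].
Qed.

Definition swap (x : X) : X := (if x.2 then x.1 else skew_shift x.1, ~~ x.2).

Lemma measurable_swap : measurable_fun setT swap.
Proof.
apply: measurable_fun_pair.
  apply: measurable_fun_ifT; [exact: measurable_snd | exact: measurable_fst |].
  exact: measurableT_comp (@measurable_skew R) measurable_fst.
have mN : measurable_fun (@setT bool) negb by move=> _ A mA.
exact: (measurableT_comp mN (@measurable_snd _ _ _ bool)).
Qed.

Lemma swap_preserves : measure_preserving mu swap.
Proof.
split; first exact: measurable_swap.
move=> A mA; have mSA : measurable (swap @^-1` A).
  by rewrite -[X in measurable X]setTI; exact: measurable_swap.
suff h : fine (mu (swap @^-1` A)) = fine (mu A).
  by rewrite -[LHS]fineK ?fin_num_measure// h fineK// fin_num_measure.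
have e := (skew_preserves R).2 _ (measurable_slice true mA).
by rewrite (fine_sheets mSA) (fine_sheets mA) [in RHS]addrC -e.
Qed.

(** One step of [swap] from the sheet [true] shows that an invariant set has equal slices; one step
    from [false] then makes the common slice shift-invariant. *)
Lemma swap_ergodic : ergodic mu swap.
Proof.
move=> A mA SA; pose B := [set w | A (w, false)].
have E1 : [set w | A (w, true)] = B by rewrite -{1}SA.
have SB : @skew_shift R @^-1` B = B by rewrite -{1}E1 /B -{2}SA.
have mB : measurable B by exact: measurable_slice.
have h : fine (mu A) = fine (haar B) by rewrite fine_sheets// E1; lra.
have -> : mu A = haar B by rewrite -[LHS]fineK ?fin_num_measure// h fineK// fin_num_measure.
exact: skew_ergodic.
Qed.

Lemma iter2_swap x : iter 2 swap x = (skew_shift x.1, x.2).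
Proof. by case: x => w []. Qed.

Lemma swap_not_totally_ergodic : ~ totally_ergodic mu swap.
Proof.
(* The square of [swap] preserves each sheet, and a sheet has measure 1/2. *)
move=> /(_ 2%N isT [set x | ~~ x.2]).
have mA : measurable ([set x | ~~ x.2] : set X).
  rewrite (_ : [set x | _] = setT `*` [set false]); first exact: measurableX.
  by apply/seteqP; split => -[w []] //= [].
have : fine (mu [set x | ~~ x.2]) = 2^-1.
  rewrite fine_sheets//= (_ : [set w : torus | ~~ false] = setT); last by apply/seteqP; split.
  rewrite (_ : [set w : torus | ~~ true] = set0); last by apply/seteqP; split.
  by rewrite measure0 [haar setT](@probability_setT _ _ _ haar) /= addr0 mulr1.
move=> h; case=> //.
- by apply/seteqP; split => x; rewrite /preimage /mkset iter2_swap.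
- by move=> h0; move: h; rewrite h0 /=; lra.
- by move=> h0; move: h; rewrite h0 /=; lra.
Qed.

End TwoSheets.

(** * The classes [Ek] for the swap and for its square *)

Section Eigenfunctions.
Context (R : realType).
Local Notation torus := (torus R).
Local Notation haar := (haar R).
Local Notation X := (torus * bool)%type.
Local Notation mu := (sheets R).
Local Notation beta := (beta R).

Definition clamp (x : R) : R := Num.max (-1) (Num.min 1 x).

Lemma clamp_norm x : `|clamp x| <= 1.
Proof.
by rewrite ler_norml /clamp le_max lexx /= ge_max ge_min lexx /= andbT; lra.
Qed.

Lemma clamp_id x : x ^+ 2 <= 1 -> clamp x = x.
Proof.
rewrite -[leRHS](expr1n _ 2) -real_normK ?num_real// ler_sqr ?nnegrE// ler_norml => /andP[h1 h2].
by rewrite /clamp (min_idPr h2) (max_idPr h1).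
Qed.

(** Members of [Ek] are unimodular only almost everywhere, while the Fourier lemmas want everywhere
    bounded functions. Clamping the two parts to [-1, 1] changes nothing where the modulus is 1. *)
Lemma unimodular_bounded (F : torus -> R[i]) : cmeasurable F ->
  {ae haar, forall w, sqmod (F w) = 1} ->
  exists2 G, cbmeas G & {ae haar, forall w, G w = F w}.
Proof.
move=> [m1 m2] F1; exists (fun w => Complex (clamp (complex.Re (F w))) (clamp (complex.Im (F w)))).
  have bc (f : torus -> R) : measurable_fun setT f -> bmeas (fun w => clamp (f w)).
    move=> mf; split; last by exists 1 => w; exact: clamp_norm.
    apply: measurable_maxr; first exact: measurable_cst.
    by apply: measurable_minr; [exact: measurable_cst | exact: mf].
  by split; exact: bc.
apply: filterS F1 => w; rewrite /sqmod => h.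
have := sqr_ge0 (complex.Re (F w)); have := sqr_ge0 (complex.Im (F w)) => h1 h2.
by apply: complexP => /=; apply: clamp_id; lra.
Qed.

(** The invariant of the induction on [k]. The clause for [m = 0] is what makes the frequency
    [l false + l true] of the next level even. *)
Definition sheetwise_char (G : X -> R[i]) := exists (C : bool -> R[i]) (l : bool -> int) (m : int),
  (m = 0 -> l false = l true) /\
  forall b, {ae haar, forall w, G (w, b) = C b * char (l b) (2 * m) w}.

Lemma cmeasurable_slice (F : X -> R[i]) b : cmeasurable F -> cmeasurable (fun w => F (w, b)).
Proof.
by move=> [m1 m2]; split; [exact: measurableT_comp m1 (pair2_measurable b) |
  exact: measurableT_comp m2 (pair2_measurable b)].
Qed.

Lemma sqmod_eq1_neq0 (F : torus -> R[i]) : {ae haar, forall w, sqmod (F w) = 1} ->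
  ~ {ae haar, forall w, F w = 0}.
Proof.
move=> F1 F0; have [w [h1 h0]] : exists w, sqmod (F w) = 1 /\ F w = 0.
  by apply: ae_exists; apply: filterS2 F1 F0.
by move: h1; rewrite h0 /sqmod /= expr0n addr0 => /eqP; rewrite eq_sym oner_eq0.
Qed.

Lemma ae_skew_shift (Q : torus -> Prop) : {ae haar, forall w, Q w} ->
  {ae haar, forall w, Q (skew_shift w)}.
Proof.
move=> [N [mN N0 QN]]; have [mS PS] := skew_preserves R.
exists (@skew_shift R @^-1` N); split.
- by rewrite -[X in measurable X]setTI; exact: mS.
- by rewrite PS.
- by move=> w /= nQ; exact: QN.
Qed.

(* Over the sheet [true] the cocycle of [F] along two steps of [swap] is the product of the two values of [G], so its
   [z]-frequency is [2 * (2 * m)]; rigidity of the skew shift forces [m = 0] and then the new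
   [z]-frequency is [l + l]. *)
Lemma sheetwise_char_step (F G : X -> R[i]) : cmeasurable F ->
  {ae mu, forall x, sqmod (F x) = 1} -> sheetwise_char G ->
  {ae mu, forall x, F (swap x) * cconj (F x) = G x} -> sheetwise_char F.
Proof.
move=> mF /ae_sheets F1 [C [l [m [hm HG]]]] /ae_sheets HF.
have F0 := HF false; have FT := HF true; rewrite /swap /= in F0 FT.
have E0 : {ae haar, forall w, F (w, false) = C true * char (l true) (2 * m) w * F (w, true)}.
  apply: filterS3 FT (HG true) (F1 true) => w h1 h2 /mul_cconj h3.
  by rewrite -h2 -h1 -mulrA [cconj _ * _]mulrC h3 mulr1.
have ES : {ae haar, forall w, F (skew_shift w, true) =
    C false * C true * char (l false + l true) (2 * m + 2 * m) w * F (w, true)}.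
  have H := ae_and F0 (ae_and (HG false) (ae_and (F1 false) E0)).
  apply: filterS H => w [h1 [h2 [/mul_cconj h3 h4]]].
  have -> : F (skew_shift w, true) = C false * char (l false) (2 * m) w * F (w, false).
    by rewrite -h2 -h1 -mulrA [cconj _ * _]mulrC h3 mulr1.
  by rewrite h4 charD; ring.
(* Rigidity needs a unimodular constant. Comparing moduli at one generic point of each sheet
   provides it. *)
have C1 b : sqmod (C b) = 1.
  have [w [h1 [h2 [h3 h4]]]] : exists w, G (w, b) = C b * char (l b) (2 * m) w /\
      (sqmod (F (swap (w, b))) = 1 /\
      (sqmod (F (w, b)) = 1 /\ F (swap (w, b)) * cconj (F (w, b)) = G (w, b))).
    apply: (@ae_exists _ _ _ haar); apply: ae_and (HG b) (ae_and _ (ae_and (F1 b) (HF b))).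
    by case: b {HG}; [exact: F1 | exact: ae_skew_shift (F1 true)].
  have := congr1 (@sqmod R) h4; rewrite h1 !sqmodM cconj_sqmod h2 h3 char_sqmod !mulr1.
  by move=> <-.
have [F' bF' FF'] := unimodular_bounded (cmeasurable_slice true mF) (F1 true).
have c1 : sqmod (C false * C true) = 1 by rewrite sqmodM !C1 mulr1.
have FS : {ae haar, forall w, F' (skew_shift w) =
    C false * C true * char (l false + l true) (2 * m + 2 * m) w * F' w}.
  by apply: filterS3 (ae_skew_shift FF') FF' ES => w -> ->.
have nF : ~ {ae haar, forall w, F' w = 0}.
  move=> F'0; apply: sqmod_eq1_neq0 (F1 true) _.
  by apply: filterS2 F'0 FF' => w <-.
have [m4 [D [p [_ FD]]]] := skew_rigidity bF' c1 FS nF.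
have m0 : m = 0 by lia.
have ET : {ae haar, forall w, F (w, true) = D * char p (l true + l true) w}.
  by apply: filterS2 FF' FD => w <- ->; rewrite (hm m0).
(* By [E0], with [m = 0], passing to the sheet [false] multiplies by [C true] and adds [l true] to
   the first frequency. If the new [m], which is [l true], vanishes, both first frequencies are
   [p]. *)
exists (fun b => if b then D else C true * D), (fun b => if b then p else l true + p), (l true); split.
  by move=> ->; rewrite add0r.
have e2 : 2 * l true = l true + l true by ring.
case; rewrite e2; first exact: ET.
apply: filterS2 E0 ET => w -> -> /=.
have -> : char (l true + p) (l true + l true) w = char (l true) 0 w * char p (l true + l true) w.
  by rewrite -charD add0r.
by rewrite m0 mulr0; ring.
Qed.

Lemma Ek_sheetwise_char k G : Ek k mu (@swap R) G -> sheetwise_char G.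
Proof.
elim: k G => [|k IH] G /=.
  move=> [_ [c [_ /ae_sheets Gc]]]; exists (fun=> c), (fun=> 0), 0; split=> // b.
  by apply: filterS (Gc b) => w ->; rewrite mulr0 char0 mulr1.
by move=> [mG [G1 [H [HH GH]]]]; exact: sheetwise_char_step mG G1 (IH _ HH) GH.
Qed.

Definition lower (x : X) : R[i] := if x.2 then 0 else char 0 1 x.1.

Lemma cbmeas_sheets (F : bool -> torus -> R[i]) : (forall b, cbmeas (F b)) ->
  cbmeas (fun x : X => F x.2 x.1).
Proof.
move=> bF; have H (f : bool -> torus -> R) : (forall b, bmeas (f b)) -> bmeas (fun x : X => f x.2 x.1).
  move=> bf; have [_ [M0 h0]] := bf false; have [_ [M1 h1]] := bf true; split.
    rewrite (_ : (fun x => _) = (fun x : X => if x.2 then f true x.1 else f false x.1)).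
      apply: measurable_fun_ifT; first exact: measurable_snd.
        exact: measurableT_comp (bf true).1 measurable_fst.
      exact: measurableT_comp (bf false).1 measurable_fst.
    by apply/funext => -[w []].
  exists (Num.max M0 M1) => -[w []] /=; rewrite le_max; first by rewrite h1 orbT.
  by rewrite h0.
by split; [apply: (H (fun b w => complex.Re (F b w))) => b; case: (bF b) |
  apply: (H (fun b w => complex.Im (F b w))) => b; case: (bF b)].
Qed.

Lemma cint_sheets (F : X -> R[i]) : cbmeas F -> cint mu F =
  Complex 2^-1 0 * (cint haar (fun w => F (w, false)) + cint haar (fun w => F (w, true))).
Proof.
move=> [b1 b2]; apply: complexP; rewrite ?Re_mul ?Im_mul ?Re_add ?Im_add /= sheets_integral//; ring.
Qed.

Lemma cbmeas_lower : cbmeas lower.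
Proof.
rewrite (_ : lower = (fun x => (fun b w => if b then 0 else char 0 1 w) x.2 x.1)) //.
by apply: (@cbmeas_sheets (fun b w => if b then 0 else char 0 1 w)) => -[];
  [exact: cbmeas_cst | exact: cbmeas_char].
Qed.

Lemma cbmeas_cmeasurable d (Y : measurableType d) (F : Y -> R[i]) : cbmeas F -> cmeasurable F.
Proof. by move=> [[? _] [? _]]. Qed.

(** Replaces [cint_ae] when an element of [Ek], not known to be bounded everywhere, occurs in the
    integrand. *)
Lemma cint_ae_measurable (F G : X -> R[i]) : cmeasurable F -> cmeasurable G ->
  {ae mu, forall x, F x = G x} -> cint mu F = cint mu G.
Proof.
move=> [F1 F2] [G1 G2] FG; rewrite /cint /Rintegral; congr (Complex (fine _) (fine _));
  apply: ae_eq_integral => //; try exact/measurable_EFinP;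
  by apply: filterS FG => x /= ->.
Qed.

Lemma cmeasurable_mul_cconj (F G : X -> R[i]) : cmeasurable F -> cmeasurable G ->
  cmeasurable (fun x => F x * cconj (G x)).
Proof.
move=> [F1 F2] [G1 G2]; split.
  under eq_fun do rewrite Re_mul /= mulrN opprK.
  by apply: measurable_funD; exact: measurable_funM.
under eq_fun do rewrite Im_mul /= mulrN addrC.
by apply: measurable_funB; exact: measurable_funM.
Qed.

Lemma lower_perp k : Ek_perp k mu (@swap R) lower.
Proof.
have [b1 b2] := cbmeas_lower; split; first exact: cbmeas_cmeasurable cbmeas_lower.
split; first by split; exact: bmeas_integrable.
move=> g Eg; have mg : cmeasurable g by case: k Eg => [|k] [].
have [C [l [m [_ /(_ false) Hg]]]] := Ek_sheetwise_char Eg.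
suff /(congr1 (fun z => (complex.Re z, complex.Im z))) : cint mu (fun x => lower x * cconj (g x)) = 0.
  by case.
pose H b w : R[i] := if b then 0 else cconj (C false) * char (- l false) (1 - 2 * m) w.
have bH : cbmeas (fun x : X => H x.2 x.1).
  apply: cbmeas_sheets => -[]; first exact: cbmeas_cst.
  exact: cbmeasZ (cbmeas_char _ _ _).
rewrite (@cint_ae_measurable _ (fun x => H x.2 x.1)).
- rewrite cint_sheets//= [X in _ + X](_ : _ = 0); last first.
    by apply: complexP; rewrite /= bintegral_cst.
  (* The second frequency [1 - 2 * m] is odd, hence nonzero, so the character integrates to 0. *)
  rewrite /H /= cintZ; last exact: cbmeas_char.
  rewrite cint_char (_ : (1 - 2 * m == 0) = false); last by apply/eqP; lia.
  by rewrite andbF mulr0 addr0 mulr0.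
- by apply: cmeasurable_mul_cconj => //; exact: cbmeas_cmeasurable cbmeas_lower.
- exact: cbmeas_cmeasurable.
- apply/ae_sheets => -[]; first by apply: aeW => w; rewrite /lower /H /= mul0r.
  apply: filterS Hg => w; rewrite /lower /H /= => ->.
  have -> : char (- l false) (1 - 2 * m) w = char 0 1 w * char (- l false) (- (2 * m)) w.
    by rewrite -charD add0r.
  by rewrite cconjM charN; ring.
Qed.

Local Notation T2 := (iter 2 (@swap R)).

Lemma cbmeas_lift p q : cbmeas (fun x : X => char p q x.1).
Proof. by apply: (@cbmeas_sheets (fun=> char p q)) => b; exact: cbmeas_char. Qed.

Lemma eigenvalue_T2 p : is_eigenvalue mu T2 (cis (p%:~R * beta)).
Proof.
exists (fun x : X => char p 0 x.1); split; [split|split].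
- exact: cbmeas_cmeasurable (cbmeas_lift _ _).
- by under eq_fun do rewrite char_sqmod; exact: (bmeas_integrable mu (bmeas_cst _ 1)).
- move=> /ae_exists[x h0]; have := char_sqmod p 0 x.1.
  by rewrite h0 /sqmod /= expr0n addr0 => /eqP; rewrite eq_sym oner_eq0.
- by apply: aeW => x; rewrite iter2_swap /= char_skew addr0.
Qed.

(** The derivative of a unimodular constant is 1, the case p = 0 at the level below; hence the
    induction is uniform in [p]. *)
Lemma Ek_T2_cst k p : Ek k mu T2 (fun=> cis (p%:~R * beta)).
Proof.
elim: k p => [|k IH] p /=.
  split; first exact: cbmeas_cmeasurable (cbmeas_cst _ _).
  by exists (cis (p%:~R * beta)); split; [exact: eigenvalue_T2 | exact: aeW].
split; first exact: cbmeas_cmeasurable (cbmeas_cst _ _).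
split; first by apply: aeW => x; exact: cis_sqmod.
exists (fun=> cis (0%:~R * beta)); split; first exact: IH.
by apply: aeW => x; rewrite mul_cconj ?cis_sqmod// mul0r cis0.
Qed.

Lemma Ek_T2_char k : (2 <= k)%N -> Ek k mu T2 (fun x => char 0 1 x.1).
Proof.
case: k => [|[|k]] // _.
have E1 j : Ek j.+1 mu T2 (fun x => char 1 0 x.1).
  split; first exact: cbmeas_cmeasurable (cbmeas_lift _ _).
  split; first by apply: aeW => x; exact: char_sqmod.
  exists (fun=> cis (1%:~R * beta)); split; first exact: Ek_T2_cst.
  by apply: aeW => x; rewrite iter2_swap /= char_skew addr0 -mulrA mul_cconj ?mulr1// char_sqmod.
split; first exact: cbmeas_cmeasurable (cbmeas_lift _ _).
split; first by apply: aeW => x; exact: char_sqmod.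
exists (fun x => char 1 0 x.1); split; first exact: E1.
apply: aeW => x; rewrite iter2_swap /= char_skew mul0r cis0 mul1r.
have -> : char (0 + 1) 1 x.1 = char 1 0 x.1 * char 0 1 x.1 by rewrite -charD.
by rewrite -mulrA mul_cconj ?mulr1// char_sqmod.
Qed.

Lemma lower_not_perp k : (2 <= k)%N -> ~ Ek_perp k mu T2 lower.
Proof.
move=> k2 [_ [_ /(_ _ (Ek_T2_char k2))[h _]]].
(* The product of [lower] with the conjugate of the character is the indicator of the sheet [false],
   whose integral is 1/2. *)
pose H b (w : torus) : R[i] := if b then 0 else 1.
have bH : cbmeas (fun x : X => H x.2 x.1).
  by apply: cbmeas_sheets => -[]; exact: cbmeas_cst.
have := cint_sheets bH => /(congr1 (@complex.Re R)).
have -> : complex.Re (cint mu (fun x : X => H x.2 x.1)) = 0.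
  rewrite -[RHS]h; apply: eq_Rintegral => x _; congr complex.Re.
  rewrite /H /lower; case: x.2; first by rewrite mul0r.
  by rewrite mul_cconj// char_sqmod.
rewrite Re_mul Re_add Im_add /= !bintegral_cst /=; lra.
Qed.

End Eigenfunctions.

(** * Averages along orbits *)

Section Averages.
Context (R : realType).
Local Notation torus := (torus R).
Local Notation beta := (beta R).
Local Notation swap := (@swap R).

Lemma iter_skew_shift m (w : torus) : iter m (@skew_shift R) w =
  (w.1 + m%:R * beta, w.2 + m%:R * w.1 + (m%:R * (m%:R - 1) / 2) * beta).
Proof.
elim: m => [|m IH]; first by case: w => t s /=; congr pair; rewrite ?mul0r ?addr0//; field.
by rewrite iterS IH /skew_shift /= -[m.+1]addn1 natrD; congr pair; field.
Qed.

Lemma iter_swap_double m (w : torus) : iter m.*2 swap (w, false) = (iter m (@skew_shift R) w, false).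
Proof. by elim: m => // m IH; rewrite doubleS !iterS IH. Qed.

Lemma lower_iter_swap n (w : torus) : lower (iter n swap (w, false)) =
  if odd n then 0
  else cis (w.2 + n%:R / 2 * w.1 + (n%:R / 2 * (n%:R / 2 - 1) / 2) * beta).
Proof.
(* At an even time n the shift has acted n / 2 times; at an odd time the point is on the sheet
   [true]. *)
rewrite -[in LHS](odd_double_half n) -[in X in cis X](odd_double_half n).
case: (odd n); first by rewrite add1n iterS iter_swap_double.
rewrite add0n iter_swap_double /lower /= /char iter_skew_shift /= mul0r add0r mul1r.
by rewrite -muln2 natrM mulfK.
Qed.

(** The sign conjugates, and the factor converts the period 2 pi of the torus coordinates to period
    1. *)
Definition phase (t : R) : R[i] := cis (- (pi *+ 2) * t).

Lemma phase_circle_continuous : circle_continuous phase.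
Proof.
split; [|split].
- move=> t; rewrite /phase mulrDr mulr1 cisD [X in _ * X](_ : _ = 1) ?mulr1//.
  by rewrite cisN /cis cos2pi sin2pi /cconj /= oppr0.
- by have := @continuous_cos_affine R (- (pi *+ 2)) 0; under eq_fun do rewrite addr0.
- have := @continuous_cos_affine R (- (pi *+ 2)) (- (pi / 2)).
  by under eq_fun do rewrite cosBpihalf.
Qed.

(** The argument of [cis] in [lower_iter_swap], expanded in powers of n and divided by 2 pi. *)
Definition orbit_poly (w : torus) : {poly R} :=
  (w.2 / (pi *+ 2))%:P + ((w.1 / 2 - beta / 4) / (pi *+ 2)) *: 'X
  + (beta / 8 / (pi *+ 2)) *: 'X^2.

Lemma size_orbit_poly w : (size (orbit_poly w) <= 3)%N.
Proof.
rewrite /orbit_poly (leq_trans (size_polyD _ _))// geq_max.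
rewrite (leq_trans (size_scale_leq _ _)) ?size_polyXn// andbT.
rewrite (leq_trans (size_polyD _ _))// geq_max (leq_trans (size_polyC_leq1 _))//=.
by rewrite (leq_trans (size_scale_leq _ _))// size_polyX.
Qed.

Lemma phase_orbit_poly (w : torus) n : phase (orbit_poly w).[n%:R] =
  cis (- (w.2 + n%:R / 2 * w.1 + (n%:R / 2 * (n%:R / 2 - 1) / 2) * beta)).
Proof.
have p0 : pi *+ 2 != 0 :> R by rewrite gt_eqF// pi2_gt0.
rewrite /phase /orbit_poly !hornerE /=; congr cis.
by move: (pi *+ 2) p0 => x x0; field.
Qed.

(** Each even time contributes exactly 1 and each odd time 0. *)
Lemma orbit_sum (w : torus) N :
  \sum_(1 <= n < N.+1) (phase (orbit_poly w).[n%:R] * lower (iter n swap (w, false))) = (N./2)%:R.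
Proof.
rewrite (eq_bigr (fun n => (~~ odd n)%:R)) => [|n _].
  elim: N => [|N IH]; first by rewrite big_geq.
  by rewrite big_nat_recr//= IH negbK -natrD addnC -uphalf_half.
by rewrite phase_orbit_poly lower_iter_swap; case: (odd n); rewrite ?mulr0// cisNK.
Qed.

Lemma wavg_not_cvg (w : torus) : ~ ctends_to0 (wavg swap phase (orbit_poly w) (@lower R) (w, false)).
Proof.
move=> [+ _] => /cvgr0Pnorm_lt/(_ 2^-1) []; first by rewrite invr_gt0.
have half M : (0 < M)%N -> complex.Re ((M.*2)%:R^-1 *: (M%:R : R[i])) = 2^-1.
  move=> M0; have M2 : (M.*2)%:R != 0 :> R[i] by rewrite pnatr_eq0 double_eq0 -lt0n.
  set z := _ *: _; have zz : z + z = 1.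
    by rewrite /z -scalerDr -natrD addnn; exact: mulVf M2.
  by have := congr1 (@complex.Re R) zz; rewrite Re_add /=; lra.
(* At the even, nonzero length [N.+1.*2] the average is exactly 1/2, which violates the strict
   bound. *)
move=> N _ /(_ N.+1.*2); rewrite /= -{1}addnn -addSnnS leq_addl => /(_ isT).
by rewrite /wavg orbit_sum doubleK half// ger0_norm ?invr_ge0// ltxx.
Qed.

End Averages.

Unset Implicit Arguments.

Theorem theorem1p3 (R : realType) :
  (* (i) *)
  (forall k : nat, (2 <= k)%N ->
    exists (d : measure_display) (X : measurableType d) (mu : probability X R) (T : X -> X),
      measure_preserving mu T /\ ergodic mu T /\
      Ek_perp k mu T <> Ek_perp k mu (iter 2 T)) /\
  (* (ii) *)
  (forall k : nat, (2 <= k)%N ->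
    exists (d : measure_display) (X : measurableType d) (mu : probability X R) (T : X -> X)
           (f : X -> R[i]),
      measure_preserving mu T /\ ergodic mu T /\ ~ totally_ergodic mu T /\
      cLinfty mu f /\ Ek_perp k mu T f /\
          ~ {ae mu, forall x, forall (phi : R -> R[i]) (P : {poly R}),
               circle_continuous phi -> (size P <= k.+1)%N ->
               ctends_to0 (wavg T phi P f x)}).
Proof.
split=> k k2.
  exists _, _, (sheets R), (@swap R).
  split; first exact: swap_preserves.
  split; first exact: swap_ergodic.
  move=> e; apply: (lower_not_perp k2).
  exact: (eq_ind _ (fun S => S (@lower R)) (@lower_perp R k) _ e).
exists _, _, (sheets R), (@swap R), (@lower R).
split; first exact: swap_preserves.
split; first exact: swap_ergodic.
split; first exact: swap_not_totally_ergodic.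
split.
  split; first exact: cbmeas_cmeasurable (cbmeas_lower R).
  have [_ [M hM]] := bmeas_sqmod (cbmeas_lower R).
  by exists M; apply: aeW => x; exact: le_trans (ler_norm _) (hM x).
split; first exact: lower_perp.
(* The average fails to converge to 0 at every point of the sheet [false], so any one point supplied
   by the almost everywhere claim refutes it. The polynomial depends on that point. *)
move=> /ae_sheets/(_ false)/ae_exists[w /(_ (@phase R) (orbit_poly w))].
move=> /(_ (@phase_circle_continuous R)) H; apply: (wavg_not_cvg (w := w)); apply: H.
exact: leq_trans (size_orbit_poly w) _.
Qed.
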